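(* Given a cograph $G$ with $n$ vertices, there exists an algorithm that computes in $O(np^7)$ time all the triples $T$ with weight at most $p$ such that $G$ admits a $T$-partition.
   Context: All graphs are finite and simple. A cograph is a graph with no induced path $P_4$ on four vertices; equivalently, a graph obtainable from single vertices by repeatedly applying disjoint union and join. Here $p$ is the given integer bound on the weight. Triples are triples $T=(a,b,c)$ of non-negative integers, and the weight of $(a,b,c)$ is $a+b+c$. For a triple $T=(a,b,c)$, a $T$-partition of $G$ is a partition $(P,Q,R)$ of $V(G)$ (parts may be empty) such that $P$ can be partitioned into $a$ (possibly empty) sets each inducing a forest, the subgraph induced on $Q$ is $b$-colourable, and $R$ has at most $c$ vertices.
   Formalization: The cograph is taken to be given by a cotree (any one; each cograph is shown to have one), since the bound fails when the graph is given by adjacency matrix or adjacency lists; also n is at least 1, and for p = 0 the factor p^7 is read as 1. *)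

(* Defs.v *)
From mathcomp Require Import all_boot.
Set Implicit Arguments.
Unset Strict Implicit.
Unset Printing Implicit Defensive.

(* A finite simple graph is a symmetric irreflexive relation
   on a finType of vertices. *)

Section Graphs.
Variables (V : finType) (e : rel V).

Definition induced_P4 (w x y z : V) : bool :=
  [&& uniq [:: w; x; y; z], e w x, e x y, e y z,
      ~~ e w y, ~~ e w z & ~~ e x z].

Definition is_cograph : Prop := forall w x y z : V, ~~ induced_P4 w x y z.

(* In a simple graph, [ucycle e c] with [2 < size c] says that [c] lists the
   vertices of a cycle; shorter [ucycle]s are a single edge or degenerate. *)
Definition induces_forest (A : {set V}) : Prop :=
  forall c : seq V, {subset c <= A} -> ucycle e c -> size c <= 2.

Definition forest_partitionable (a : nat) (P : {set V}) : Prop :=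
  exists F : 'I_a -> {set V},
    [/\ P = \bigcup_(i < a) F i,
        forall i j : 'I_a, i != j -> [disjoint F i & F j]
      & forall i : 'I_a, induces_forest (F i)].

(* Colours are naturals below [b], so that [b = 0] is possible exactly when
   [Q] is empty. *)
Definition induces_colourable (b : nat) (Q : {set V}) : Prop :=
  exists col : V -> nat,
    (forall u, u \in Q -> col u < b) /\
    (forall u v, u \in Q -> v \in Q -> e u v -> col u <> col v).

Definition triple : Type := (nat * nat * nat)%type.

Definition weight (T : triple) : nat := let: (a, b, c) := T in a + b + c.

Definition admits_partition (T : triple) : Prop :=
  let: (a, b, c) := T in
  exists P Q R : {set V},
    [/\ P :|: Q :|: R = [set: V],
        [/\ [disjoint P & Q], [disjoint P & R] & [disjoint Q & R]],
        forest_partitionable a P,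
        induces_colourable b Q
      & #|R| <= c].

End Graphs.

(* Cotrees: the expressions building a cograph from single vertices by
   disjoint union and join. *)
Inductive cotree (V : Type) : Type :=
| Vertex of V
| DisjointUnion of cotree V & cotree V
| Join of cotree V & cotree V.

Fixpoint leaves (V : Type) (t : cotree V) : seq V :=
  match t with
  | Vertex v => [:: v]
  | DisjointUnion l r | Join l r => leaves l ++ leaves r
  end.

Fixpoint cotree_adj (V : eqType) (t : cotree V) (u v : V) : bool :=
  match t with
  | Vertex _ => false
  | DisjointUnion l r => cotree_adj l u v || cotree_adj r u v
  | Join l r =>
      [|| cotree_adj l u v, cotree_adj r u v,
          (u \in leaves l) && (v \in leaves r)
        | (u \in leaves r) && (v \in leaves l)]
  end.

(* Every vertex labels exactly one leaf. *)
Definition cotree_of (V : finType) (e : rel V) (t : cotree V) : Prop :=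
  perm_eq (leaves t) (enum V) /\ forall u v, e u v = cotree_adj t u v.

(* Word RAM.  Programs are structured (no jumps), memory is an array of
   natural numbers with indirect addressing, and every constant, memory
   access, arithmetic operation, assignment and test costs one unit.
   Subtraction is truncated.  The parameter [W] bounds the machine words: a
   program gets stuck as soon as some constant, address, intermediate result
   or stored value is not below [W]. *)
Inductive expr : Type :=
| Const of nat
| Read of expr
| Add of expr & expr
| Sub of expr & expr
| Mul of expr & expr.

Inductive program : Type :=
| Skip
| Write of expr & expr
| Seq of program & program
| Cond of expr & program & program
| While of expr & program.

Definition memory : Type := nat -> nat.

Fixpoint eval (m : memory) (x : expr) : nat :=
  match x with
  | Const c => c
  | Read a => m (eval m a)
  | Add a b => eval m a + eval m b
  | Sub a b => eval m a - eval m b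
  | Mul a b => eval m a * eval m b
  end.

Fixpoint fits (W : nat) (m : memory) (x : expr) : bool :=
  (eval m x < W) &&
  match x with
  | Const _ => true
  | Read a => fits W m a
  | Add a b | Sub a b | Mul a b => fits W m a && fits W m b
  end.

Fixpoint cost (x : expr) : nat :=
  match x with
  | Const _ => 1
  | Read a => (cost a).+1
  | Add a b | Sub a b | Mul a b => (cost a + cost b).+1
  end.

Definition update (m : memory) (a v : nat) : memory :=
  fun i => if i == a then v else m i.

(* [exec W M m s m']: started in memory [m], the program [M] halts in memory
   [m'] after exactly [s] time units.  A test succeeds when it is nonzero. *)
Inductive exec (W : nat) : program -> memory -> nat -> memory -> Prop :=
| ExecSkip m :
    exec W Skip m 1 m
| ExecWrite a x m :
    fits W m a -> fits W m x ->
    exec W (Write a x) m (cost a + cost x).+1 (update m (eval m a) (eval m x))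
| ExecSeq M1 M2 m m1 m2 s1 s2 :
    exec W M1 m s1 m1 -> exec W M2 m1 s2 m2 ->
    exec W (Seq M1 M2) m (s1 + s2) m2
| ExecCond x M1 M2 m m' s :
    fits W m x -> exec W (if eval m x != 0 then M1 else M2) m s m' ->
    exec W (Cond x M1 M2) m (cost x + s).+1 m'
| ExecWhileEnd x M m :
    fits W m x -> eval m x = 0 ->
    exec W (While x M) m (cost x).+1 m
| ExecWhileStep x M m m1 m2 s1 s2 :
    fits W m x -> eval m x != 0 ->
    exec W M m s1 m1 -> exec W (While x M) m1 s2 m2 ->
    exec W (While x M) m (cost x + s1 + s2).+1 m2.

(* A cograph on the vertices 0, ..., n-1 is given to the machine by a cotree,
   in postfix notation: 0 is disjoint union, 1 is join, v + 2 is the vertex v. *)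
Fixpoint cotree_code (n : nat) (t : cotree 'I_n) : seq nat :=
  match t with
  | Vertex v => [:: v + 2]
  | DisjointUnion l r => cotree_code l ++ cotree_code r ++ [:: 0]
  | Join l r => cotree_code l ++ cotree_code r ++ [:: 1]
  end.

(* Initially cell 0 holds the weight bound, cell 1 the length of the code, the
   next cells the code, and all other cells hold 0. *)
Definition input (n p : nat) (t : cotree 'I_n) : memory :=
  nth 0 (p :: size (cotree_code t) :: cotree_code t).

(* Finally cell 0 holds the address of an array of triples stored
   consecutively, and cell 1 the number of these triples. *)
Definition output (m : memory) : seq triple :=
  [seq (m (m 0 + 3 * i), m (m 0 + 3 * i + 1), m (m 0 + 3 * i + 2))
  | i <- iota 0 (m 1)].

(* Main.v *)
Require Import Defs.
From mathcomp Require Import all_boot zify.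
(* Again, as [eqtype] has its own [Sub]. *)
Import Defs.
Set Implicit Arguments.
Unset Strict Implicit.
Unset Printing Implicit Defensive.

(* In a disjoint union the forests and the colour classes of the two sides can
   be merged one by one, so only the third component of the triples is split.
   In a join of [G1] and [G2], an independent set lies on one side, and so does
   a forest, unless it is a star: at most one vertex on one side and an
   independent set on the other (anything else contains a triangle or a C4).
   A star centred in [G1] counts once as a forest of the join, once as a vertex
   of [R] in [G1] and once as a colour class of [G2].  Hence the triples of a
   join are obtained from a triple of [G1], a triple of [G2] and the number of
   stars, which is seven numbers of size at most [p]; trying all of them at each
   of the O(n) nodes of the cotree takes O(n p^7) steps. *)

(** * Cotrees of cographs *)

(** On the graph side, covers by possibly overlapping sets replace partitions, so that merging,
    restricting and forming stars need no care for disjointness; it is restored once, at the end, by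
    a greedy choice. On the machine side, every node gets a table of [(p + 1) ^ 3] cells. Storing
    only triples of weight at most [p] loses nothing: a union splits [c], and in a join a star costs
    one in [a] and one in the triple of each child, so neither child has a heavier triple than its
    parent. A join seems to need eight numbers, as the stars centred on the left and on the right
    play different roles for the children. The resulting triple depends only on their sum, however,
    and it is easy to tell which sums can be split suitably; this saves a factor [p]. That a cotree
    exists at all rests on a classical fact: a cograph with at least two vertices is disconnected or
    has a disconnected complement. *)

Lemma cotree_adj_leaves (V : eqType) (t : cotree V) u v :
  cotree_adj t u v -> (u \in leaves t) && (v \in leaves t).
Proof.
elim: t => //= l IHl r IHr; rewrite !mem_cat.
  by case/orP => [/IHl|/IHr] /andP[-> ->]; rewrite ?orbT.
by case/or4P => [/IHl|/IHr||] /andP[-> ->]; rewrite ?orbT.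
Qed.

Section Cotrees.
Variables (V : finType).
Implicit Types (e : rel V) (S A B : {set V}).

Definition P4_free e := forall w x y z, ~~ induced_P4 e w x y z.

Definition complement e : rel V := fun x y => (x != y) && ~~ e x y.

Definition no_edge e S A := forall x y, x \in A -> y \in S :\: A -> ~~ e x y.

(** Disconnectedness of the graph induced on [S]. A split of the complement is a decomposition as a
    join. *)
Definition splits e S :=
  exists A, [/\ A \subset S, A != set0, S :\: A != set0 & no_edge e S A].

Lemma complement_sym e : symmetric e -> symmetric (complement e).
Proof. by move=> se x y; rewrite /complement eq_sym se. Qed.

Lemma complement_irr e : irreflexive (complement e).
Proof. by move=> x; rewrite /complement eqxx. Qed.

(** The path on four vertices is self-complementary: an induced path [w x y z] of the complement is
    the induced path [y w z x] of [e]. *)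
Lemma complement_P4 e : symmetric e -> P4_free e -> P4_free (complement e).
Proof.
move=> se pe w x y z; apply/negP => /and5P[/=].
rewrite !inE !negb_or /complement => /and4P[/and3P[wx wy wz] /andP[xy xz] yz _].
move=> /andP[_ nwx] /andP[_ nxy] /andP[_ nyz] /and3P[].
rewrite wy wz xz /= !negbK => ewy ewz exz.
have /negP[] := pe y w z x; rewrite /induced_P4 /= !inE !negb_or.
rewrite (se y w) ewy ewz (se z x) exz nyz (se y x) nxy nwx.
by rewrite eq_sym wy yz (eq_sym y x) xy wz wx (eq_sym z x) xz.
Qed.

Lemma complement_K e : irreflexive e -> complement (complement e) =2 e.
Proof.
move=> ie x y; rewrite /complement negb_and !negbK.
by case: eqVneq => [->|]; rewrite ?ie.
Qed.

(* If [v] misses some [w] in [A] and meets some [u] outside [A], the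
   non-neighbours of [v] in [A] are one side of a split: an edge [x y] from one
   of them to a neighbour [y] of [v] in [A] would give the path [x y v u]. *)
Lemma splits_add e S v : symmetric e -> irreflexive e -> P4_free e ->
  v \notin S -> splits e S -> splits e (v |: S) \/ splits (complement e) (v |: S).
Proof.
move=> se ie pe vS [A [AS A0 B0 nAB]].
(* A vertex adjacent to all of [S] is isolated in the complement, where it splits off. *)
have [full|] := boolP [forall w in S, e v w].
  right; exists [set v]; split.
  - by rewrite sub1set setU11.
  - by apply/set0Pn; exists v; rewrite inE.
  - case/set0Pn: A0 => a aA; have aS := subsetP AS _ aA.
    apply/set0Pn; exists a; rewrite !inE aS orbT andbT.
    by apply: contraNneq vS => <-.
  - move=> x y /set1P-> ; rewrite !inE => /andP[/negbTE-> /= yS].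
    by rewrite /complement (forall_inP full _ yS) andbF.
rewrite negb_forall_in => /exists_inP[w wS nvw]; left.
wlog wA : A AS A0 B0 nAB / w \in A.
  move=> H; have [wA|wA] := boolP (w \in A); first exact: (H A).
  apply: (H (S :\: A)) => //; rewrite ?subsetDl //.
  - by rewrite setDDr setDv set0U (setIidPr AS).
  - move=> x y xB; rewrite setDDr setDv set0U (setIidPr AS) => yA.
    by rewrite se; apply: nAB.
  - by rewrite inE wA.
have vNin x : x \in S -> x != v by move=> xS; apply: contraNneq vS => <-.
(* If [v] has no neighbour outside [A], the side [S :\: A] stays cut off when [v] is added. *)
have [/exists_inP[u uB evu]|] := boolP [exists u in S :\: A, e v u]; last first.
  rewrite negb_exists_in => /forall_inP nv.
  exists (S :\: A); split => //.
  - by apply: subset_trans (subsetDl _ _) (subsetUr _ _).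
  - apply/set0Pn; exists v; rewrite !inE eqxx (negbTE vS) //=.
    by rewrite andbF.
  move=> x y xB; rewrite !inE => /andP[yB /orP[/eqP->|yS]].
    by rewrite se; apply: nv.
  by rewrite se; apply: nAB => //; move: yB; rewrite negb_and negbK yS orbF.
have /setDP[uS uA] := uB.
exists [set x in A | ~~ e v x]; split.
- apply/subsetP=> x; rewrite !inE => /andP[xA _].
  by rewrite (subsetP AS) ?orbT.
- by apply/set0Pn; exists w; rewrite !inE wA.
- have vA : v \notin A by apply: contra vS => /(subsetP AS).
  by apply/set0Pn; exists v; rewrite !inE eqxx (negbTE vA).
move=> x y; rewrite !inE => /andP[xA nvx].
rewrite negb_and negbK => /andP[H /orP[/eqP->|yS]]; first by rewrite se.
case: (boolP (y \in A)) H => [yA /= evy|yA _]; last first.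
  by apply: nAB => //; rewrite inE yA.
apply/negP => exy; have /negP[] := pe x y v u.
have xS := subsetP AS _ xA.
have nxu : ~~ e x u by apply: nAB.
have nyu : ~~ e y u by apply: nAB.
have neu z : z \in A -> z != u by move=> zA; apply: contraNneq uA => <-.
apply/and5P; split=> //=; last by rewrite (se x v) nvx nxu nyu.
- have xy : x != y by apply: contraTneq exy => ->; rewrite ie.
  by rewrite !inE !negb_or xy (vNin x) ?(vNin y) ?(neu x) ?(neu y) //= eq_sym vNin.
- by rewrite se.
Qed.

(** Induction on [#|S|], removing one vertex [v]: a split of the rest, in [e] or in its complement,
    survives the return of [v] by [splits_add], which applies to both graphs as P4-freeness passes
    to the complement. *)
Lemma cograph_splits e S : symmetric e -> irreflexive e -> P4_free e ->
  1 < #|S| -> splits e S \/ splits (complement e) S.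
Proof.
move=> se ie pe; move: {2}#|S| (erefl #|S|) => k; elim: k S => [|k IH] S cS.
  by rewrite cS.
have /card_gt0P[v vS] : 0 < #|S| by rewrite cS.
rewrite (cardsD1 v) vS add1n => cS'.
rewrite -(setD1K vS); set S' := S :\ v in cS' *.
have vS' : v \notin S' by rewrite !inE eqxx.
have cS'k : #|S'| = k by move: cS; rewrite (cardsD1 v) vS -/S'; lia.
have [c1|c1] := ltnP 1 #|S'|; last first.
  have /cards1P[w Sw] : #|S'| == 1 by lia.
  have wv : w != v by apply: contraNneq vS' => <-; rewrite Sw inE.
  have [evw|nvw] := boolP (e v w); [right|left]; exists [set v]; split.
  - by rewrite sub1set setU11.
  - by apply/set0Pn; exists v; rewrite inE.
  - by apply/set0Pn; exists w; rewrite Sw !inE wv eqxx orbT.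
  - move=> x y /set1P->; rewrite Sw !inE => /andP[/negbTE-> /= /eqP->].
    by rewrite /complement evw andbF.
  - by rewrite sub1set setU11.
  - by apply/set0Pn; exists v; rewrite inE.
  - by apply/set0Pn; exists w; rewrite Sw !inE wv eqxx orbT.
  - by move=> x y /set1P->; rewrite Sw !inE => /andP[/negbTE-> /= /eqP->].
case: (IH S' cS'k c1) => [|sp]; first exact: splits_add.
(* Here [splits_add] works in the complement, so its second outcome is a split of the double
   complement, that is, of [e]. *)
have [] := splits_add (complement_sym se) (@complement_irr e) (complement_P4 se pe) vS' sp.
  by right.
case=> A [? ? ? nA]; left; exists A; split=> // x y xA yA.
by rewrite -(complement_K ie); apply: nA.
Qed.

(** Strong induction on [#|S|]: a split of [e] yields a [DisjointUnion], a split of the complement a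
    [Join]. *)
Lemma cotree_exists e S : symmetric e -> irreflexive e -> P4_free e ->
  0 < #|S| -> exists t : cotree V, perm_eq (leaves t) (enum S) /\
    {in S &, forall u v, e u v = cotree_adj t u v}.
Proof.
move=> se ie pe; have [k] := ubnP #|S|; elim: k S => // k IH S cSk S0.
have [c1|c1] := ltnP 1 #|S|; last first.
  have /cards1P[w ->] : #|S| == 1 by lia.
  exists (Vertex w); split; first by rewrite /= enum_set1.
  by move=> u v /set1P-> /set1P->; rewrite ie.
have permS A : A \subset S -> forall s1 s2, perm_eq s1 (enum A) -> perm_eq s2 (enum (S :\: A)) ->
    perm_eq (s1 ++ s2) (enum S).
  move=> AS s1 s2 p1 p2; apply: perm_trans (perm_cat p1 p2) _.
  apply: uniq_perm; rewrite ?enum_uniq //.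
    rewrite cat_uniq !enum_uniq andbT /=; apply/hasPn => x.
    by rewrite !mem_enum !inE => /andP[].
  move=> x; rewrite mem_cat !mem_enum !inE.
  by case: (boolP (x \in A)) => // /(subsetP AS)->.
have sub A : A \subset S -> A != set0 -> S :\: A != set0 -> exists l r,
  [/\ perm_eq (leaves l) (enum A), perm_eq (leaves r) (enum (S :\: A)),
     {in A &, forall u v, e u v = cotree_adj l u v} &
     {in S :\: A &, forall u v, e u v = cotree_adj r u v}].
  move=> AS A0 B0.
  have cS : #|S| = #|A| + #|S :\: A| by rewrite -(cardsID A S) (setIidPr AS).
  move: A0 B0; rewrite -!card_gt0 => A0 B0.
  have [|l [? ?]] := IH A _ A0; first lia.
  have [|r [? ?]] := IH (S :\: A) _ B0; first lia.
  by exists l, r.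
have adjF (t : cotree V) B u v : perm_eq (leaves t) (enum B) -> ~~ ((u \in B) && (v \in B)) ->
   cotree_adj t u v = false.
  move=> pt; apply: contraNF => /cotree_adj_leaves.
  by rewrite !(perm_mem pt) !mem_enum.
have [] := cograph_splits se ie pe c1 => -[A [AS A0 B0 nA]];
  have [l [r [pl pr el er]]] := sub A AS A0 B0.
- exists (DisjointUnion l r); split; first by apply: (permS A).
  move=> u v uS vS /=.
  case: (boolP (u \in A)) => uA; case: (boolP (v \in A)) => vA.
  + by rewrite el // (adjF r (S :\: A)) ?orbF // !inE uA.
  + rewrite (adjF l A) ?(adjF r (S :\: A)) ?inE ?uA ?(negbTE vA) //.
    by apply/negbTE/nA; rewrite ?inE ?vA.
  + rewrite (adjF l A) ?(adjF r (S :\: A)) ?inE ?(negbTE uA) ?vA // ?andbF //.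
    by rewrite se; apply/negbTE/nA; rewrite ?inE ?uA.
  + by rewrite er ?inE ?uA ?vA // (adjF l A) // (negbTE uA).
- have full u v : u \in A -> v \in S :\: A -> e u v.
    move=> uA vB; move: (nA _ _ uA vB); rewrite /complement negb_and !negbK.
    by case/orP => // /eqP uv; move: vB; rewrite -uv inE uA.
  exists (Join l r); split; first by apply: (permS A).
  move=> u v uS vS /=; rewrite !(perm_mem pl) !(perm_mem pr) !mem_enum !inE uS vS !andbT.
  case: (boolP (u \in A)) => uA; case: (boolP (v \in A)) => vA /=; rewrite ?orbT ?orbF.
  + by rewrite el // (adjF r (S :\: A)) ?orbF // !inE uA.
  + by rewrite full // inE vA.
  + by rewrite se full // inE uA.
  + by rewrite er ?inE ?uA ?vA // (adjF l A) // (negbTE uA).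
Qed.

End Cotrees.

(** * Triples admitted by unions and joins *)

Section Covers.
Variables (V : finType) (e : rel V).
Hypotheses (e_sym : symmetric e) (e_irr : irreflexive e).
Implicit Types (S U X Y : {set V}).

Definition independent X := forall u v, u \in X -> v \in X -> ~~ e u v.

(* The sets may overlap and may stick out of the covered set; as forests,
   independent sets and small sets are hereditary, this changes nothing. *)
Inductive cover : {set V} -> nat -> nat -> nat -> Prop :=
| cover0 : cover set0 0 0 0
| cover_forest U U' X a b c : cover U a b c -> induces_forest e X ->
    U' \subset X :|: U -> cover U' a.+1 b c
| cover_indep U U' X a b c : cover U a b c -> independent X ->
    U' \subset X :|: U -> cover U' a b.+1 c
| cover_small U U' X a b c : cover U a b c -> #|X| <= 1 ->
    U' \subset X :|: U -> cover U' a b c.+1.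

Lemma forestS X Y : X \subset Y -> induces_forest e Y -> induces_forest e X.
Proof. by move=> XY fY c cX; apply: fY => u /cX /(subsetP XY). Qed.

Lemma independentS X Y : X \subset Y -> independent Y -> independent X.
Proof. by move=> XY iY u v /(subsetP XY) uY /(subsetP XY); apply: iY. Qed.

Lemma coverS U U' a b c : U' \subset U -> cover U a b c -> cover U' a b c.
Proof.
move=> UU h; case: h UU => [|U1 U2 X ? ? ? h f s|U1 U2 X ? ? ? h f s|U1 U2 X ? ? ? h f s] UU.
- by move: UU; rewrite subset0 => /eqP->; exact: cover0.
- exact: cover_forest h f (subset_trans UU s).
- exact: cover_indep h f (subset_trans UU s).
- exact: cover_small h f (subset_trans UU s).
Qed.

Lemma cover_add U1 U2 a1 b1 c1 a2 b2 c2 : cover U1 a1 b1 c1 -> cover U2 a2 b2 c2 ->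
  cover (U1 :|: U2) (a1 + a2) (b1 + b2) (c1 + c2).
Proof.
move=> h h2; elim: h => [|U U' X a b c _ IH f s|U U' X a b c _ IH f s|U U' X a b c _ IH f s].
- by rewrite set0U.
- by apply: (cover_forest IH f); rewrite setUA setSU.
- by apply: (cover_indep IH f); rewrite setUA setSU.
- by apply: (cover_small IH f); rewrite setUA setSU.
Qed.

Lemma coverWc U a b c : cover U a b c -> cover U a b c.+1.
Proof. by move=> h; apply: (@cover_small U U set0 a b c); rewrite ?cards0 ?set0U. Qed.

(** The order in which a cover is built does not matter: a forest added early can be taken off
    first, the sets added after it being put back onto the rest. The same argument serves for
    independent and small sets. *)
Lemma peel_forest U a b c : cover U a.+1 b c ->
  exists X U', [/\ induces_forest e X, cover U' a b c & U \subset X :|: U'].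
Proof.
move Da: a.+1 => a' h; elim: h a Da => //.
- by move=> {}U U' X a'' b' c' h IH f s a [->]; exists X, U.
- move=> {}U U' X a'' b' c' _ IH f s a /IH [Y [U1 [fY c1 s1]]].
  exists Y, (X :|: U1); split=> //; first exact: cover_indep c1 f (subxx _).
  by rewrite setUCA; apply: subset_trans s (setUS _ s1).
- move=> {}U U' X a'' b' c' _ IH f s a /IH [Y [U1 [fY c1 s1]]].
  exists Y, (X :|: U1); split=> //; first exact: cover_small c1 f (subxx _).
  by rewrite setUCA; apply: subset_trans s (setUS _ s1).
Qed.

Lemma peel_indep U a b c : cover U a b.+1 c ->
  exists X U', [/\ independent X, cover U' a b c & U \subset X :|: U'].
Proof.
move Db: b.+1 => b' h; elim: h b Db => //.
- move=> {}U U' X a' b'' c' _ IH f s b /IH [Y [U1 [fY c1 s1]]].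
  exists Y, (X :|: U1); split=> //; first exact: cover_forest c1 f (subxx _).
  by rewrite setUCA; apply: subset_trans s (setUS _ s1).
- by move=> {}U U' X a' b'' c' h IH f s b [->]; exists X, U.
- move=> {}U U' X a' b'' c' _ IH f s b /IH [Y [U1 [fY c1 s1]]].
  exists Y, (X :|: U1); split=> //; first exact: cover_small c1 f (subxx _).
  by rewrite setUCA; apply: subset_trans s (setUS _ s1).
Qed.

Lemma peel_small U a b c : cover U a b c.+1 ->
  exists X U', [/\ #|X| <= 1, cover U' a b c & U \subset X :|: U'].
Proof.
move Dc: c.+1 => c' h; elim: h c Dc => //.
- move=> {}U U' X a' b' c'' _ IH f s c /IH [Y [U1 [fY c1 s1]]].
  exists Y, (X :|: U1); split=> //; first exact: cover_forest c1 f (subxx _).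
  by rewrite setUCA; apply: subset_trans s (setUS _ s1).
- move=> {}U U' X a' b' c'' _ IH f s c /IH [Y [U1 [fY c1 s1]]].
  exists Y, (X :|: U1); split=> //; first exact: cover_indep c1 f (subxx _).
  by rewrite setUCA; apply: subset_trans s (setUS _ s1).
- by move=> {}U U' X a' b' c'' h IH f s c [->]; exists X, U.
Qed.

(** Every edge inside [X :|: Y] has an end in [X], so all of them share one vertex. In a cycle
    [u, v, w, ...] of length at least 3, the edges [uv], [vw] and the closing edge at [u] have no
    common vertex. *)
Lemma forest_star X Y : #|X| <= 1 -> independent Y -> induces_forest e (X :|: Y).
Proof.
move=> X1 iY c cXY /andP[cyc un].
have X_eq u v : u \in X -> v \in X -> u = v by move=> uX vX; apply: (card_le1_eqP X1).
have edge u v : u \in c -> v \in c -> e u v -> (u \in X) || (v \in X).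
  move=> /cXY /setUP[->//|uY] /cXY /setUP[->|vY] euv; first by rewrite orbT.
  by have := iY _ _ uY vY; rewrite euv.
case: c cXY un cyc edge => [|u [|v [|w c]]] //= _ un.
rewrite rcons_path => /and4P[euv evw _ ewu] edge.
have lastc : last w c \in w :: c by exact: mem_last.
have lastin : last w c \in [:: u, v, w & c] by rewrite in_cons in_cons lastc !orbT.
have uc : u \in [:: u, v, w & c] by rewrite mem_head.
have vc : v \in [:: u, v, w & c] by rewrite in_cons mem_head orbT.
have wc : w \in [:: u, v, w & c] by rewrite !in_cons eqxx !orbT.
have uv := edge _ _ uc vc euv; have vw := edge _ _ vc wc evw.
have wu := edge _ _ lastin uc ewu.
move: un; rewrite -/(uniq (w :: c)) => /and3P[unu unv _].
have nuv : u != v by apply: contraNneq unu => ->; rewrite mem_head.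
have nuw : u != w by apply: contraNneq unu => ->; rewrite !inE eqxx orbT.
have nul : u != last w c by apply: contraNneq unu => ->; rewrite in_cons lastc orbT.
have nvw : v != w by apply: contraNneq unv => ->; rewrite mem_head.
have nvl : v != last w c by apply: contraNneq unv => ->.
case/orP: uv => X1'; [case/orP: vw => X2'|case/orP: wu => X2'].
- by rewrite (X_eq u v) ?eqxx in nuv.
- by rewrite (X_eq u w) ?eqxx in nuw.
- by rewrite (X_eq v (last w c)) ?eqxx in nvl.
- by rewrite (X_eq u v) ?eqxx in nuv.
Qed.

Lemma independent_forest X : independent X -> induces_forest e X.
Proof. by move=> iX; rewrite -[X]set0U; apply: forest_star; rewrite ?cards0. Qed.

Lemma small_independent X : #|X| <= 1 -> independent X.
Proof. by move=> X1 u v uX vX; rewrite ((card_le1_eqP X1) _ _ uX vX) e_irr. Qed.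

Definition separated S1 S2 := forall u v, u \in S1 -> v \in S2 -> ~~ e u v.
Definition joined S1 S2 := forall u v, u \in S1 -> v \in S2 -> e u v.

(** No edge crosses from [X] to [Y], so membership in [X] is constant along a cycle, which therefore
    lies in one of the two forests. *)
Lemma forest_union S1 S2 X Y : [disjoint S1 & S2] -> separated S1 S2 ->
  X \subset S1 -> Y \subset S2 ->
  induces_forest e X -> induces_forest e Y -> induces_forest e (X :|: Y).
Proof.
move=> dS sep XS YS fX fY [//|u c] cXY uc.
have step x y : x \in u :: c -> y \in u :: c -> e x y -> (x \in X) = (y \in X).
  move=> xc yc exy; apply/idP/idP => [xX|yX].
    have /setUP[//|yY] := cXY _ yc.
    by have := sep _ _ (subsetP XS _ xX) (subsetP YS _ yY); rewrite exy.
  have /setUP[//|xY] := cXY _ xc.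
  by have := sep _ _ (subsetP XS _ yX) (subsetP YS _ xY); rewrite e_sym exy.
have walk s v : path e v s -> v \in u :: c -> {subset s <= u :: c} ->
    {in v :: s, forall x, (x \in X) = (v \in X)}.
  elim: s v => [|w s IH] v /=; first by move=> _ _ _ x; rewrite inE => /eqP->.
  case/andP=> evw ps vc sc x; rewrite inE => /predU1P[->//|xs].
  have wc : w \in u :: c by apply: sc; rewrite mem_head.
  rewrite (step _ _ vc wc evw); apply: IH => // y ys.
  by apply: sc; rewrite inE ys orbT.
have all_same : {in u :: c, forall x, (x \in X) = (u \in X)}.
  have /andP[] := uc; rewrite /= rcons_path => /andP[pc _] _.
  by apply: walk => // [|x xc]; rewrite ?mem_head // in_cons xc orbT.
have [uX|uX] := boolP (u \in X); first by apply: fX uc => x /all_same; rewrite uX.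
apply: fY uc => x xc; have /setUP[xX|//] := cXY _ xc.
by move: xX; rewrite all_same // (negbTE uX).
Qed.

(** * Composing covers over unions and joins, and splitting them over unions *)

Section Parts.
Variables S1 S2 : {set V}.
Hypothesis dS : [disjoint S1 & S2].

Section Union.
Hypothesis sep : separated S1 S2.

(** Forests, then independent sets, are peeled from both covers in parallel and merged in pairs.
    Once both kinds are used up only small sets remain, and their numbers add up. *)
Lemma cover_union U1 U2 a b c1 c2 : U1 \subset S1 -> U2 \subset S2 ->
  cover U1 a b c1 -> cover U2 a b c2 -> cover (U1 :|: U2) a b (c1 + c2).
Proof.
elim: a U1 U2 => [|a IHa] U1 U2 s1 s2; last first.
  move=> /peel_forest[X1 [T1 [f1 h1 t1]]] /peel_forest[X2 [T2 [f2 h2 t2]]].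
  (* What is left of a cover may stick out of its side, so it is cut down to the side before the
     induction hypothesis applies. *)
  have h := IHa _ _ (subsetIr T1 S1) (subsetIr T2 S2)
    (coverS (subsetIl _ _) h1) (coverS (subsetIl _ _) h2).
  apply: (@cover_forest _ _ ((X1 :&: S1) :|: (X2 :&: S2)) _ _ _ h).
    apply: (forest_union dS sep); rewrite ?subsetIr //.
      exact: forestS (subsetIl _ _) f1.
    exact: forestS (subsetIl _ _) f2.
  rewrite setUACA -!setIUl; apply: setUSS; first by rewrite subsetI t1.
  by rewrite subsetI t2.
elim: b U1 U2 s1 s2 => [|b IHb] U1 U2 s1 s2; last first.
  move=> /peel_indep[X1 [T1 [f1 h1 t1]]] /peel_indep[X2 [T2 [f2 h2 t2]]].
  have h := IHb _ _ (subsetIr T1 S1) (subsetIr T2 S2)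
    (coverS (subsetIl _ _) h1) (coverS (subsetIl _ _) h2).
  apply: (@cover_indep _ _ ((X1 :&: S1) :|: (X2 :&: S2)) _ _ _ h).
    move=> u v /setUP[] /setIP[uX uS] /setUP[] /setIP[vX vS].
    - exact: f1.
    - exact: sep.
    - by rewrite e_sym; apply: sep.
    - exact: f2.
  rewrite setUACA -!setIUl; apply: setUSS; first by rewrite subsetI t1.
  by rewrite subsetI t2.
by move=> h1 h2; apply: cover_add h1 h2.
Qed.
End Union.

(** Forests and independent sets are restricted to both sides at no cost. A small set meets only one
    side and is charged there, hence the splitting of [c]. *)
Lemma cover_split U a b c : cover U a b c -> exists c1 c2,
  [/\ c = c1 + c2, cover (U :&: S1) a b c1 & cover (U :&: S2) a b c2].
Proof.
elim=> [|{}U U' X {}a {}b {}c _ [c1 [c2 [-> h1 h2]]] f s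
       |{}U U' X {}a {}b {}c _ [c1 [c2 [-> h1 h2]]] f s
       |{}U U' X {}a {}b {}c _ [c1 [c2 [-> h1 h2]]] f s].
- by exists 0, 0; rewrite !set0I; split=> //; exact: cover0.
- exists c1, c2; split=> //.
    by apply: (cover_forest h1 (forestS (subsetIl X S1) f)); rewrite -setIUl setSI.
  by apply: (cover_forest h2 (forestS (subsetIl X S2) f)); rewrite -setIUl setSI.
- exists c1, c2; split=> //.
    by apply: (cover_indep h1 (independentS (subsetIl X S1) f)); rewrite -setIUl setSI.
  by apply: (cover_indep h2 (independentS (subsetIl X S2) f)); rewrite -setIUl setSI.
- have [XS1|XS1] := boolP (X :&: S1 == set0).
    exists c1, c2.+1; split; rewrite ?addnS //.
      by apply: coverS h1; apply: subset_trans (setSI _ s) _; rewrite setIUl (eqP XS1) set0U.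
    apply: (@cover_small _ _ X _ _ _ h2 f).
    by apply: subset_trans (setSI _ s) _; rewrite setIUl setSU // subsetIl.
  exists c1.+1, c2; split => //.
    apply: (@cover_small _ _ X _ _ _ h1 f).
    by apply: subset_trans (setSI _ s) _; rewrite setIUl setSU // subsetIl.
  suff XS2 : X :&: S2 = set0.
    by apply: coverS h2; apply: subset_trans (setSI _ s) _; rewrite setIUl XS2 set0U.
  apply/setP=> x; rewrite !inE; apply/negP => /andP[xX xS2].
  case/set0Pn: XS1 => y /setIP[yX yS1].
  have xy : x = y by apply: (card_le1_eqP f).
  by rewrite -xy (disjointFl dS xS2) in yS1.
Qed.

Hypothesis join : joined S1 S2.

(** Each of the [s1] stars combines a small set of the first cover, its centre, with an independent
    set of the second; each of the [s2] stars does so with the sides exchanged. What remains after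
    all stars are peeled is added up. *)
Lemma cover_join U1 U2 a1 b1 c1 a2 b2 c2 s1 s2 : U1 \subset S1 -> U2 \subset S2 ->
  cover U1 a1 (b1 + s2) (c1 + s1) -> cover U2 a2 (b2 + s1) (c2 + s2) ->
  cover (U1 :|: U2) (a1 + a2 + s1 + s2) (b1 + b2) (c1 + c2).
Proof.
elim: s1 U1 U2 => [|s1 IH] U1 U2 t1 t2; rewrite ?addnS ?addn0.
  elim: s2 U1 U2 t1 t2 => [|s2 IH] U1 U2 t1 t2; rewrite ?addnS ?addn0.
    exact: cover_add.
  move=> /peel_indep[X1 [T1 [f1 h1 r1]]] /peel_small[X2 [T2 [f2 h2 r2]]].
  have h := IH _ _ (subsetIr T1 S1) (subsetIr T2 S2)
    (coverS (subsetIl _ _) h1) (coverS (subsetIl _ _) h2).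
  apply: (@cover_forest _ _ ((X1 :&: S1) :|: (X2 :&: S2)) _ _ _ h).
    rewrite setUC; apply: forest_star; last exact: independentS (subsetIl _ _) f1.
    exact: leq_trans (subset_leq_card (subsetIl _ _)) f2.
  rewrite setUACA -!setIUl; apply: setUSS; first by rewrite subsetI r1.
  by rewrite subsetI r2.
move=> /peel_small[X1 [T1 [f1 h1 r1]]] /peel_indep[X2 [T2 [f2 h2 r2]]].
have h := IH _ _ (subsetIr T1 S1) (subsetIr T2 S2)
    (coverS (subsetIl _ _) h1) (coverS (subsetIl _ _) h2).
rewrite addSn; apply: (@cover_forest _ _ ((X1 :&: S1) :|: (X2 :&: S2)) _ _ _ h).
  apply: forest_star; last exact: independentS (subsetIl _ _) f2.
  exact: leq_trans (subset_leq_card (subsetIl _ _)) f1.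
rewrite setUACA -!setIUl; apply: setUSS; first by rewrite subsetI r1.
by rewrite subsetI r2.
Qed.

Lemma indep_joined X : independent X -> X :&: S1 = set0 \/ X :&: S2 = set0.
Proof.
move=> iX; have [->|/set0Pn[u /setIP[uX uS]]] := eqVneq (X :&: S1) set0; first by left.
have [->|/set0Pn[v /setIP[vX vS]]] := eqVneq (X :&: S2) set0; first by right.
by have := iX _ _ uX vX; rewrite join.
Qed.
End Parts.

Lemma forest_triangle_free X u v w : induces_forest e X ->
  u \in X -> v \in X -> w \in X -> e u v -> e v w -> ~~ e u w.
Proof.
move=> fX uX vX wX euv evw; apply/negP => euw.
have nuv : u != v by apply: contraTneq euv => ->; rewrite e_irr.
have nvw : v != w by apply: contraTneq evw => ->; rewrite e_irr.
have nuw : u != w by apply: contraTneq euw => ->; rewrite e_irr.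
have /fX : {subset [:: u; v; w] <= X} by move=> x; rewrite !inE => /or3P[] /eqP->.
suff uc : ucycle e [:: u; v; w] by move/(_ uc).
by rewrite /ucycle /= !inE !negb_or nuv nuw nvw euv evw (e_sym w u) euw.
Qed.

(** * Splitting covers over joins *)

Section Join.
Variables S1 S2 : {set V}.
Hypotheses (dS : [disjoint S1 & S2]) (join : joined S1 S2).

Lemma joined_sym : joined S2 S1.
Proof. by move=> u v uS vS; rewrite e_sym join. Qed.

Lemma forest_joined X : induces_forest e X ->
  [\/ X :&: S1 = set0, X :&: S2 = set0,
      #|X :&: S1| <= 1 /\ independent (X :&: S2) |
      #|X :&: S2| <= 1 /\ independent (X :&: S1)].
Proof.
move=> fX.
have star T1 T2 : joined T1 T2 -> X :&: T1 != set0 -> independent (X :&: T2).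
  move=> jT /set0Pn[x /setIP[xX xT]] u v /setIP[uX uT] /setIP[vX vT].
  apply/negP => euv; have := forest_triangle_free fX xX uX vX (jT _ _ xT uT) euv.
  by rewrite jT.
have [X1|X1] := eqVneq (X :&: S1) set0; first by constructor 1.
have [X2|X2] := eqVneq (X :&: S2) set0; first by constructor 2.
have [c1|c1] := leqP #|X :&: S1| 1.
  by constructor 3; split=> //; apply: star X1.
have [c2|c2] := leqP #|X :&: S2| 1.
  by constructor 4; split=> //; apply: star X2; exact: joined_sym.
have [u [v [/setIP[uX uS] /setIP[vX vS] uv]]] := card_gt1P c1.
have [w [z [/setIP[wX wS] /setIP[zX zS] wz]]] := card_gt1P c2.
have ne x y : x \in S1 -> y \in S2 -> x != y.
  by move=> xS yS; apply: contraTneq yS => <-; rewrite (disjointFr dS).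
(* Two vertices on each side form a 4-cycle that alternates between the sides. *)
have /fX : {subset [:: u; w; v; z] <= X} by move=> x; rewrite !inE => /or4P[] /eqP->.
suff uc : ucycle e [:: u; w; v; z] by move/(_ uc).
rewrite /ucycle /= !inE !negb_or uv wz (ne u w) // (ne u z) // (ne v z) // eq_sym (ne v w) //.
by rewrite (e_sym w) (e_sym z) (join uS wS) (join vS wS) (join vS zS) (join uS zS).
Qed.

(** Bookkeeping along the cover: each set raises exactly one of the eight numbers. A forest raises
    [a1], [a2], [s1] or [s2] according to [forest_joined]; an independent or small set lies on one
    side and is counted there. *)
Lemma cover_unjoin U0 a0 b0 c0 : cover U0 a0 b0 c0 -> exists a1 a2 b1 b2 c1 c2 s1 s2,
  [/\ [/\ a0 = a1 + a2 + s1 + s2, b0 = b1 + b2 & c0 = c1 + c2],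
     cover (U0 :&: S1) a1 (b1 + s2) (c1 + s1) & cover (U0 :&: S2) a2 (b2 + s1) (c2 + s2)].
Proof.
have skip W U U' X a' b' c' : cover (U :&: W) a' b' c' -> X :&: W = set0 -> U' \subset X :|: U ->
  cover (U' :&: W) a' b' c'.
  move=> h X0 s; apply: coverS h.
  by apply: subset_trans (setSI _ s) _; rewrite setIUl X0 set0U.
have sI W U U' X : U' \subset X :|: U -> U' :&: W \subset (X :&: W) :|: (U :&: W).
  by move=> s; rewrite -setIUl setSI.
have fI W X : induces_forest e X -> induces_forest e (X :&: W).
  by apply: forestS; apply: subsetIl.
elim=> [|U U' X a b c _ [a1 [a2 [b1 [b2 [c1 [c2 [s1 [s2 [[-> -> ->] h1 h2]]]]]]]]] f s
       |U U' X a b c _ [a1 [a2 [b1 [b2 [c1 [c2 [s1 [s2 [[-> -> ->] h1 h2]]]]]]]]] f s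
       |U U' X a b c _ [a1 [a2 [b1 [b2 [c1 [c2 [s1 [s2 [[-> -> ->] h1 h2]]]]]]]]] f s].
- by exists 0, 0, 0, 0, 0, 0, 0, 0; rewrite !set0I; split=> //; exact: cover0.
- have [X1|X2|[X1 X2]|[X2 X1]] := forest_joined f.
  + exists a1, a2.+1, b1, b2, c1, c2, s1, s2; split; [split; lia | exact: skip h1 X1 s |].
    exact: cover_forest h2 (fI _ _ f) (sI _ _ _ _ s).
  + exists a1.+1, a2, b1, b2, c1, c2, s1, s2; split; [split; lia | | exact: skip h2 X2 s].
    exact: cover_forest h1 (fI _ _ f) (sI _ _ _ _ s).
  + exists a1, a2, b1, b2, c1, c2, s1.+1, s2; split; [split; lia | |]; rewrite addnS.
      exact: cover_small h1 X1 (sI _ _ _ _ s).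
    exact: cover_indep h2 X2 (sI _ _ _ _ s).
  + exists a1, a2, b1, b2, c1, c2, s1, s2.+1; split; [split; lia | |]; rewrite addnS.
      exact: cover_indep h1 X1 (sI _ _ _ _ s).
    exact: cover_small h2 X2 (sI _ _ _ _ s).
- have [X1|X2] := indep_joined join f.
  + exists a1, a2, b1, b2.+1, c1, c2, s1, s2; split; [split; lia | exact: skip h1 X1 s |].
    exact: cover_indep h2 (independentS (subsetIl _ _) f) (sI _ _ _ _ s).
  + exists a1, a2, b1.+1, b2, c1, c2, s1, s2; split; [split; lia | | exact: skip h2 X2 s].
    exact: cover_indep h1 (independentS (subsetIl _ _) f) (sI _ _ _ _ s).
- have cI W : #|X :&: W| <= 1 by apply: leq_trans (subset_leq_card (subsetIl _ _)) f.
  have [X1|X2] := indep_joined join (small_independent f).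
  + exists a1, a2, b1, b2, c1, c2.+1, s1, s2; split; [split; lia | exact: skip h1 X1 s |].
    exact: cover_small h2 (cI _) (sI _ _ _ _ s).
  + exists a1, a2, b1, b2, c1.+1, c2, s1, s2; split; [split; lia | | exact: skip h2 X2 s].
    exact: cover_small h1 (cI _) (sI _ _ _ _ s).
Qed.
End Join.

(** * Covers of the whole graph and partitions *)

Lemma cover_bounded_sets U a b c : cover U a b c ->
  exists (f g : nat -> {set V}) (R : {set V}),
  [/\ forall i, i < a -> induces_forest e (f i),
      forall i, i < b -> independent (g i), #|R| <= c &
      forall u, u \in U ->
        [\/ u \in R, exists2 i, i < a & u \in f i | exists2 i, i < b & u \in g i]].
Proof.
elim=> [|{}U U' X {}a {}b {}c _ [f [g [R [Hf Hg HR HU]]]] fX s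
       |{}U U' X {}a {}b {}c _ [f [g [R [Hf Hg HR HU]]]] fX s
       |{}U U' X {}a {}b {}c _ [f [g [R [Hf Hg HR HU]]]] fX s].
- exists (fun _ => set0), (fun _ => set0), set0; split=> //; first by rewrite cards0.
  by move=> u; rewrite inE.
- exists (fun i => if i is j.+1 then f j else X), g, R; split=> //; first by case.
  move=> u /(subsetP s) /setUP[uX|/HU[|[i ? ?]|]]; last by constructor 3.
  + by constructor 2; exists 0.
  + by constructor 1.
  + by constructor 2; exists i.+1.
- exists f, (fun i => if i is j.+1 then g j else X), R; split=> //; first by case.
  move=> u /(subsetP s) /setUP[uX|/HU[||[i ? ?]]].
  + by constructor 3; exists 0.
  + by constructor 1.
  + by constructor 2.
  + by constructor 3; exists i.+1.
- exists f, g, (X :|: R); split=> //.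
    by apply: leq_trans (leq_card_setU _ _) _; rewrite -add1n leq_add.
  move=> u /(subsetP s) /setUP[uX|/HU[uR||]].
  + by constructor 1; rewrite inE uX.
  + by constructor 1; rewrite inE uR orbT.
  + by constructor 2.
  + by constructor 3.
Qed.

(** Overlaps are removed greedily: a vertex goes to [R] if it can, otherwise to the first forest
    containing it, otherwise to the remaining part, where its colour is the index of the first
    independent set containing it. *)
Lemma cover_admits a b c : cover [set: V] a b c -> admits_partition e (a, b, c).
Proof.
case/cover_bounded_sets => f [g [R [Hf Hg HR HU]]].
pose F (i : 'I_a) := f i :\: R :\: \bigcup_(j < a | j < i) f j.
have Fsub i : F i \subset f i.
  by apply: subset_trans (subsetDl _ _) (subsetDl _ _).
pose P := \bigcup_(i < a) F i.
have PR u : u \in P -> u \notin R by case/bigcupP => i _ /setDP[/setDP[]].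
exists P, (~: (P :|: R)), R; split=> //.
- by apply/setP => u; rewrite !inE; case: (u \in P); case: (u \in R).
- split; rewrite -setI_eq0; apply/eqP/setP => u; rewrite !inE.
  + by case: (u \in P).
  + by apply/negP => /andP[/PR/negP].
  + by case: (u \in P); case: (u \in R).
- exists F; split=> //; last by move=> i; apply: forestS (Fsub i) (Hf _ _).
  suff H (i j : 'I_a) : i < j -> [disjoint F i & F j].
    move=> i j; rewrite neq_ltn => /orP[/H//|/H]; by rewrite disjoint_sym.
  move=> ij; rewrite -setI_eq0; apply/eqP/setP => u; rewrite [RHS]inE.
  apply/negP => /setIP[/(subsetP (Fsub i)) ui /setDP[_ /negP[]]].
  by apply/bigcupP; exists i.
- pose col u := find (fun i => u \in g i) (iota 0 b).
  have inQ u : u \in ~: (P :|: R) -> has (fun i => u \in g i) (iota 0 b).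
    rewrite !inE negb_or => /andP[uP uR].
    have [uR'|[i ia ui]|[i ib ui]] := HU u (in_setT u); first by rewrite uR' in uR.
      case/negP: uP.
      (* A vertex of some [f i] outside [R] lies in [F j] for the least possible [j], hence in
         [P]. *)
      have [j uj jmin] :=
        @arg_minnP _ (Ordinal ia) (fun j : 'I_a => u \in f j) (@nat_of_ord a) ui.
      apply/bigcupP; exists j => //; rewrite !inE uR uj !andbT.
      apply/bigcupP => -[k kj uk]; have := jmin k uk; lia.
    by apply/hasP; exists i => //; rewrite mem_iota.
  have colb u : u \in ~: (P :|: R) -> col u < b.
    by move/inQ; rewrite has_find size_iota.
  exists col; split=> // u v uQ vQ euv cuv.
  have gu := nth_find 0 (inQ u uQ); have gv := nth_find 0 (inQ v vQ).
  have cu := colb u uQ.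
  move: gu gv; rewrite -/(col u) -/(col v) -cuv nth_iota // add0n => gu gv.
  by have := Hg _ cu _ _ gu gv; rewrite euv.
Qed.

Lemma admits_cover a b c : admits_partition e (a, b, c) -> cover [set: V] a b c.
Proof.
case=> P [Q [R [PQR _ [F [PE _ fF]] [col [colb colP]] Rc]]].
move: PQR; rewrite {}PE => PQR.
have hP k : k <= a -> cover (\bigcup_(i < a | i < k) F i) k 0 0.
  elim: k => [|k IH] ka; first by rewrite big1 //; exact: cover0.
  apply: (cover_forest (IH (ltnW ka)) (fF (Ordinal ka))).
  apply/bigcupsP => i; rewrite ltnS leq_eqVlt => /orP[/eqP ik|ik].
    by rewrite (_ : i = Ordinal ka) ?subsetUl //; apply/val_inj.
  by apply: subset_trans (subsetUr _ _); apply: bigcup_sup.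
have hQ k : cover [set u in Q | col u < k] 0 k 0.
  elim: k => [|k IH]; first by apply: coverS cover0; apply/subsetP => u; rewrite !inE andbF.
  apply: (@cover_indep _ _ [set u in Q | col u == k] _ _ _ IH).
    move=> u v; rewrite !inE => /andP[uQ /eqP cu] /andP[vQ /eqP cv].
    by apply/negP => /(colP _ _ uQ vQ); rewrite cu cv.
  by apply/subsetP=> u; rewrite !inE ltnS leq_eqVlt -andb_orr.
have hR k : #|R| <= k -> cover R 0 0 k.
  elim: k {PQR Rc} R => [|k IH] R Rk.
    by apply: coverS cover0; rewrite subset0 -cards_eq0; lia.
  (* [R] may have fewer than [c] vertices; the missing small sets are taken to be empty. *)
  have [->|/set0Pn[x xR]] := eqVneq R set0.
    by apply: coverWc; apply: IH; rewrite cards0.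
  apply: (@cover_small (R :\ x) _ [set x]); rewrite ?cards1 ?setD1K //.
  by apply: IH; move: Rk; rewrite (cardsD1 x) xR.
have := cover_add (cover_add (hP a (leqnn a)) (hQ b)) (hR c Rc).
rewrite !addn0 !add0n; apply: coverS; rewrite -PQR.
apply/setSU/setUSS; last by apply/subsetP => u uQ; rewrite inE uQ colb.
by apply/bigcupsP => i _; apply: bigcup_sup.
Qed.

End Covers.

(* In a join, [s1] stars are centred in [l] and [s2] in [r]. *)
Fixpoint admitted (V : Type) (t : cotree V) (a b c : nat) : Prop :=
  match t with
  | Vertex _ => 0 < a + b + c
  | DisjointUnion l r => exists c1 c2,
      [/\ c = c1 + c2, admitted l a b c1 & admitted r a b c2]
  | Join l r => exists a1 a2 b1 b2 c1 c2 s1 s2,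
      [/\ [/\ a = a1 + a2 + s1 + s2, b = b1 + b2 & c = c1 + c2],
          admitted l a1 (b1 + s2) (c1 + s1) & admitted r a2 (b2 + s1) (c2 + s2)]
  end.

(** Induction on the cotree, whose two sides at the root are separated or joined. At a leaf, one set
    of any kind covers the single vertex, and no set covers nothing. *)
Lemma cover_leaves (V : finType) (e : rel V) (t : cotree V) a b c :
  symmetric e -> irreflexive e -> uniq (leaves t) ->
  {in leaves t &, forall u v, e u v = cotree_adj t u v} ->
  cover e [set v in leaves t] a b c <-> admitted t a b c.
Proof.
move=> se ie.
elim: t a b c => [v|l IHl r IHr|l IHl r IHr] a b c /=.
- move=> _ _; split.
    have : v \in [set v0 in [:: v]] by rewrite !inE.
    move=> H h; case: h H => [|? ? ? ? ? ?|? ? ? ? ? ?|? ? ? ? ? ?]; rewrite ?inE //; lia.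
  have X1 : #|[set v0 in [:: v]]| <= 1 by rewrite set_seq1 cards1.
  have iX := small_independent ie X1; have fX := independent_forest iX.
  set X := [set _ in _] in X1 iX fX *.
  have cov0 a' b' c' : cover e set0 a' b' c'.
    elim: c' => [|c' IH]; last exact: coverWc.
    elim: b' => [|b' IH]; last by apply: (cover_indep IH iX); rewrite sub0set.
    elim: a' => [|a' IH]; first exact: cover0.
    by apply: (cover_forest IH fX); rewrite sub0set.
  case: c => [|c] => [|_]; last by apply: (cover_small (cov0 a b c) X1); rewrite setU0.
  case: b => [|b] => [|_]; last by apply: (cover_indep (cov0 a b 0) iX); rewrite setU0.
  by case: a => // a _; apply: (cover_forest (cov0 a 0 0) fX); rewrite setU0.
- rewrite cat_uniq => /and3P[ul /hasPn dlr ur] adj.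
  have dS : [disjoint [set v in leaves l] & [set v in leaves r]].
    rewrite -setI_eq0; apply/eqP/setP => u; rewrite !inE.
    by apply/negP => /andP[ul' /dlr/negP].
  have notr u : u \in leaves l -> (u \in leaves r) = false.
    by move=> h; apply/negP => /dlr /negP.
  have adjr u v : u \in leaves l -> cotree_adj r u v = false.
    by move=> h; apply/negP => /cotree_adj_leaves; rewrite (notr u).
  have adjl u v : u \in leaves r -> cotree_adj l u v = false.
    by move=> h; apply/negP => /cotree_adj_leaves /andP[/notr]; rewrite h.
  have adjr' u v : v \in leaves l -> cotree_adj r u v = false.
    by move=> h; apply/negP => /cotree_adj_leaves; rewrite (notr v) // andbF.
  have sep : separated e [set v in leaves l] [set v in leaves r].
    move=> u v; rewrite !inE => ul' vr'.
    rewrite adj ?mem_cat ?ul' ?vr' ?orbT // (adjr u) // orbF.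
    by apply/negP => /cotree_adj_leaves /andP[_ /notr]; rewrite vr'.
  have el : {in leaves l &, forall u v, e u v = cotree_adj l u v}.
    by move=> u v h1 h2; rewrite adj ?mem_cat ?h1 ?h2 // (adjr u) // orbF.
  have er : {in leaves r &, forall u v, e u v = cotree_adj r u v}.
    by move=> u v h1 h2; rewrite adj ?mem_cat ?h1 ?h2 ?orbT // (adjl u).
  have E : [set v in leaves l ++ leaves r] = [set v in leaves l] :|: [set v in leaves r].
    by apply/setP => u; rewrite !inE mem_cat.
  rewrite E; split.
    move=> /(cover_split dS)[c1 [c2 [-> h1 h2]]]; exists c1, c2; split=> //.
      by apply/IHl => //; apply: coverS h1; rewrite setUK.
    by apply/IHr => //; apply: coverS h2; rewrite setUC setUK.
  by case=> c1 [c2 [-> /IHl h1 /IHr h2]]; apply: (cover_union se dS sep); auto.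
- rewrite cat_uniq => /and3P[ul /hasPn dlr ur] adj.
  have dS : [disjoint [set v in leaves l] & [set v in leaves r]].
    rewrite -setI_eq0; apply/eqP/setP => u; rewrite !inE.
    by apply/negP => /andP[ul' /dlr/negP].
  have notr u : u \in leaves l -> (u \in leaves r) = false.
    by move=> h; apply/negP => /dlr /negP.
  have notl u : u \in leaves r -> (u \in leaves l) = false.
    by move=> h; apply/negP => /notr; rewrite h.
  have adjr u v : u \in leaves l -> cotree_adj r u v = false.
    by move=> h; apply/negP => /cotree_adj_leaves; rewrite (notr u).
  have adjl u v : u \in leaves r -> cotree_adj l u v = false.
    by move=> h; apply/negP => /cotree_adj_leaves /andP[/notr]; rewrite h.
  have join : joined e [set v in leaves l] [set v in leaves r].
    move=> u v; rewrite !inE => ul' vr'.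
    by rewrite adj ?mem_cat ?ul' ?vr' ?orbT.
  have el : {in leaves l &, forall u v, e u v = cotree_adj l u v}.
    move=> u v h1 h2; rewrite adj ?mem_cat ?h1 ?h2 // (adjr u) //.
    by rewrite (notr u) // (notr v) // andbF !orbF.
  have er : {in leaves r &, forall u v, e u v = cotree_adj r u v}.
    move=> u v h1 h2; rewrite adj ?mem_cat ?h1 ?h2 ?orbT // (adjl u) //.
    by rewrite (notl u) // (notl v) // andbF !orbF.
  have E : [set v in leaves l ++ leaves r] = [set v in leaves l] :|: [set v in leaves r].
    by apply/setP => u; rewrite !inE mem_cat.
  rewrite E; split.
    move=> /(cover_unjoin se ie dS join)[a1 [a2 [b1 [b2 [c1 [c2 [s1 [s2 [H h1 h2]]]]]]]]].
    exists a1, a2, b1, b2, c1, c2, s1, s2; split=> //.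
      by apply/IHl => //; apply: coverS h1; rewrite setUK.
    by apply/IHr => //; apply: coverS h2; rewrite setUC setUK.
  move=> [a1 [a2 [b1 [b2 [c1 [c2 [s1 [s2 [[-> -> ->] /IHl h1 /IHr h2]]]]]]]]].
  by apply: (cover_join (S1 := [set v in leaves l]) (S2 := [set v in leaves r])); auto.
Qed.

Lemma admits_cotree (n : nat) (e : rel 'I_n) t a b c :
  symmetric e -> irreflexive e -> cotree_of e t ->
  admits_partition e (a, b, c) <-> admitted t a b c.
Proof.
move=> se ie [pt et].
have ut : uniq (leaves t) by rewrite (perm_uniq pt) enum_uniq.
have E : [set v in leaves t] = [set: 'I_n].
  by apply/setP => v; rewrite !inE (perm_mem pt) mem_enum.
have := cover_leaves a b c se ie ut (in2W et); rewrite E => H.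
split=> [/admits_cover/H//|/H]; exact: cover_admits.
Qed.

(** * Running time of structured programs *)

(** An exponent: if all cells and constants are below [X], the value is below [X ^ expr_size x]. A
    [Read] keeps the exponent of its address, since the address has to fit into a word as well. *)
Fixpoint expr_size (x : expr) : nat :=
  match x with
  | Const _ => 1
  | Read a => expr_size a
  | Add a b | Sub a b | Mul a b => expr_size a + expr_size b
  end.

Fixpoint max_const (x : expr) : nat :=
  match x with
  | Const c => c
  | Read a => max_const a
  | Add a b | Sub a b | Mul a b => maxn (max_const a) (max_const b)
  end.

(** Limits met by every expression of the program: 11 is its largest constant, and 200 leaves
    slack. *)
Definition small x := (expr_size x <= 200) && (max_const x <= 11).

Definition bounded X (m : memory) := forall a, m a < X.

Lemma update_eq m a v : update m a v a = v.
Proof. by rewrite /update eqxx. Qed.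

Lemma update_ne m a v i : i != a -> update m a v i = m i.
Proof. by rewrite /update => /negbTE->. Qed.

Lemma bounded_update X m a v : bounded X m -> v < X -> bounded X (update m a v).
Proof. by move=> h vX i; rewrite /update; case: eqP. Qed.

Lemma eval_lt X m x : 1 < X -> bounded X m -> max_const x < X -> eval m x < X ^ expr_size x.
Proof.
move=> X1 hm; have pos k : 0 < X ^ k by rewrite expn_gt0; lia.
have size_gt0 y : 0 < expr_size y by elim: y => //= a IHa b IHb; lia.
have big y : X <= X ^ expr_size y by rewrite -{1}(expn1 X) leq_exp2l.
elim: x => [c|a IH|a IHa b IHb|a IHa b IHb|a IHa b IHb] /=.
- by rewrite expn1.
- by move=> _; apply: leq_trans (big a).
- rewrite gtn_max => /andP[/IHa ha /IHb hb]; rewrite expnD.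
  have := big a; have := big b; nia.
- rewrite gtn_max => /andP[/IHa ha /IHb hb]; rewrite expnD.
  have := big a; have := big b; nia.
- rewrite gtn_max => /andP[/IHa ha /IHb hb]; rewrite expnD.
  nia.
Qed.

(* A definition because arithmetic tactics expand a power with a numeral exponent. *)
Definition wide W X := X ^ 200 <= W.

Lemma fits_small W X m x : 11 < X -> wide W X -> bounded X m -> small x -> fits W m x.
Proof.
move=> X11 XW hm /andP[].
have lt y : expr_size y <= 200 -> max_const y <= 11 -> eval m y < W.
  move=> sy cy; apply: (leq_trans _ XW); apply: leq_trans (leq_pexp2l _ sy); last lia.
  by apply: eval_lt => //; lia.
elim: x => [c|a IH|a IHa b IHb|a IHa b IHb|a IHa b IHb] s mc;
  have := lt _ s mc; move: s mc => /= s mc -> //=; move: mc; rewrite ?geq_max.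
- by move=> ?; apply: IH.
- by case/andP=> ca cb; rewrite IHa ?IHb //; lia.
- by case/andP=> ca cb; rewrite IHa ?IHb //; lia.
- by case/andP=> ca cb; rewrite IHa ?IHb //; lia.
Qed.

Definition runs W M m B (Q : memory -> Prop) :=
  exists s m', [/\ exec W M m s m', s <= B & Q m'].

(* The input leaves no fixed cell free.  With [L] the length of the code, read
   from cell 1, variable [v] is cell [L + v + 2]: variables 0 to 6 are loop
   counters, 7 is the position in the code and 8 the number of triples listed. *)
Definition var v := Add (Read (Const 1)) (Const v.+2).
Definition get v := Read (var v).
Definition sideE := Add (Read (Const 0)) (Const 1).

(** As subtraction is truncated, the test says that the counter is below [hi]. *)
Definition For v hi M :=
  Seq (Write (var v) (Const 0))
      (While (Sub hi (get v)) (Seq M (Write (var v) (Add (get v) (Const 1))))).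

Fixpoint nest v r M := if r is r'.+1 then For v sideE (nest v.+1 r' M) else M.

(** The values of the counters in the order in which [nest] runs through them. *)
Fixpoint tuples q r : seq (seq nat) :=
  if r is r'.+1 then [seq x :: t | x <- iota 0 q, t <- tuples q r'] else [:: [::]].

Lemma mem_tuples q r t : (t \in tuples q r) = (size t == r) && all (fun x => x < q) t.
Proof.
elim: r t => [|r IH] [|x t] //=.
- by apply/negbTE/negP => /allpairsPdep[? [? []]].
apply/allpairsPdep/idP => [[y [s []]]|].
  by rewrite mem_iota IH => yq /andP[/eqP ss qs] [-> ->]; rewrite eqSS ss eqxx qs andbT.
rewrite eqSS => /andP[st /andP[xq qt]]; exists x, t; split=> //; last by rewrite IH st.
by rewrite mem_iota.
Qed.

Lemma size_tuples q r : size (tuples q r) = q ^ r.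
Proof. by elim: r => //= r IH; rewrite size_allpairs size_iota IH expnS. Qed.

Lemma tuples_uniq q r : uniq (tuples q r).
Proof.
elim: r => //= r IH; apply: allpairs_uniq; rewrite ?iota_uniq //.
by move=> [x s] [y t] _ _ /= [-> ->].
Qed.

Section Runs.
Variables W X : nat.
Hypotheses (X11 : 11 < X) (XW : wide W X).

Lemma runs_weaken M m B B' (Q Q' : memory -> Prop) :
  runs W M m B Q -> B <= B' -> (forall m', Q m' -> Q' m') -> runs W M m B' Q'.
Proof.
by case=> s [m' [h sB q]] BB imp; exists s, m'; split; [|exact: leq_trans BB|exact: imp].
Qed.

Lemma runs_skip m B (Q : memory -> Prop) : 0 < B -> Q m -> runs W Skip m B Q.
Proof. by move=> B0 q; exists 1, m; split=> //; constructor. Qed.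

Lemma runs_write a x m B (Q : memory -> Prop) :
  bounded X m -> small a -> small x -> cost a + cost x < B ->
  Q (update m (eval m a) (eval m x)) -> runs W (Write a x) m B Q.
Proof.
move=> hm sa sx cB q; exists (cost a + cost x).+1; eexists; split; last exact: q; last by [].
by constructor; apply: fits_small hm _.
Qed.

Lemma runs_seq M1 M2 m B1 B2 B (Q : memory -> Prop) :
  runs W M1 m B1 (fun m1 => runs W M2 m1 B2 Q) -> B1 + B2 <= B -> runs W (Seq M1 M2) m B Q.
Proof.
move=> [s1 [m1 [h1 c1 [s2 [m2 [h2 c2 q]]]]]] BB; exists (s1 + s2), m2; split=> //.
- exact: ExecSeq h1 h2.
- by apply: leq_trans BB; apply: leq_add.
Qed.

Lemma runs_cond x M1 M2 m B B' (Q : memory -> Prop) :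
  bounded X m -> small x -> runs W (if eval m x != 0 then M1 else M2) m B Q ->
  cost x + B < B' -> runs W (Cond x M1 M2) m B' Q.
Proof.
move=> hm sx [s [m' [h c q]]] BB; exists (cost x + s).+1, m'; split=> //; last lia.
by constructor => //; apply: fits_small hm sx.
Qed.

(** The invariant has to survive any value up to [N] in the counter of the loop, including the final
    [N], so the value of the counter is tracked separately. *)
Lemma runs_for L N B v hi M (I : nat -> memory -> Prop) m :
  (forall k m', I k m' -> [/\ bounded X m', m' 1 = L & eval m' hi = N]) ->
  (forall k m' x, x <= N -> I k m' -> I k (update m' (L + v.+2) x)) ->
  (forall k m', k < N -> I k m' -> m' (L + v.+2) = k ->
     runs W M m' B (fun m2 => I k.+1 m2 /\ m2 (L + v.+2) = k)) ->
  v < 9 -> small (Sub hi (get v)) -> cost hi <= 4 -> 0 < N -> I 0 m ->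
  runs W (For v hi M) m (N * (B + 50)) (I N).
Proof.
move=> I_inv I_upd body v9 s_hi c_hi N0 I0.
have s_var : small (var v) by rewrite /small /=; lia.
have s_incr : small (Add (get v) (Const 1)) by rewrite /small /=; lia.
have [hm m1 mN] := I_inv _ _ I0.
suff loop d k m' : k + d = N -> m' (L + v.+2) = k -> I k m' ->
    runs W (While (Sub hi (get v)) (Seq M (Write (var v) (Add (get v) (Const 1)))))
      (* A round costs 23 besides the body, the last test at most 17 and the initialisation 6; as
         [N] is positive, 50 per round pays for all. *)
      m' (17 + d * (B + 23)) (I N).
  apply: (@runs_seq _ _ _ 6 (17 + N * (B + 23))); last by nia.
  apply: runs_write => //=; rewrite m1; apply: (loop N 0) => //.
    exact: update_eq.
  exact: I_upd.
elim: d k m' => [|d IH] k {hm m1 mN I0}m kN mv Ik; have [hm m1 mN] := I_inv _ _ Ik.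
  have Nk : N = k by lia.
  eexists; exists m; split.
  - apply: ExecWhileEnd; first by apply: fits_small hm s_hi.
    by rewrite /= mN m1 mv; lia.
  - rewrite /=; lia.
  - by rewrite Nk.
have kN' : k < N by lia.
have [s1 [m2 [h1 c1 [Ik2 mv2]]]] := body k m kN' Ik mv.
have [hm2 m21 m2N] := I_inv _ _ Ik2.
have Ik3 := I_upd _ _ k.+1 kN' Ik2.
have [|s2 [m3 [h2 c2 q]]] := IH k.+1 _ _ (update_eq _ _ _) Ik3; first lia.
eexists; exists m3; split; last exact: q.
- apply: (ExecWhileStep (m1 := update m2 (L + v.+2) k.+1)); last exact: h2.
  + by apply: fits_small hm s_hi.
  + by rewrite /= mN m1 mv; lia.
  + apply: ExecSeq h1 _.
    have -> : L + v.+2 = eval m2 (var v) by rewrite /= m21.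
    have -> : k.+1 = eval m2 (Add (get v) (Const 1)) by rewrite /= m21 mv2 addn1.
    by constructor; apply: fits_small hm2 _.
- rewrite /=; nia.
Qed.

(* [J d] holds after the tuples [d] of counter values have been processed. *)
Section Nest.
Variables (L p : nat) (K B : nat) (M : program) (J : seq (seq nat) -> memory -> Prop).
Local Notation q := (p + 1).
Hypothesis qX : q < X.
Hypothesis J_inv : forall d m, J d m -> [/\ bounded X m, m 0 = p & m 1 = L].
Hypothesis J_upd : forall d m v x, v < 7 -> x <= q -> J d m -> J d (update m (L + v.+2) x).
Definition vals (m : memory) k := mkseq (fun v => m (L + v.+2)) k.
Hypothesis K7 : K <= 7.
Hypothesis J_body : forall d m, J d m -> size d < q ^ K ->
  (forall v, v < K -> m (L + v.+2) < q) ->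
  runs W M m B (fun m' => J (rcons d (vals m K)) m' /\
                          forall v, v < K -> m' (L + v.+2) = m (L + v.+2)).

(** The [v] outer counters form a fixed prefix, and the history [d] grows by all tuples extending
    it. The bound on [size d] tells the body that fewer than [q ^ K] tuples have been processed,
    which keeps the length of an output list within a word. *)
Lemma runs_nest_from r v d m : v + r = K -> J d m -> (forall u, u < v -> m (L + u.+2) < q) ->
  size d + q ^ r <= q ^ K ->
  runs W (nest v r M) m (q ^ r * (B + 50 * r))
    (fun m' => J (d ++ [seq vals m v ++ t | t <- tuples q r]) m' /\
               forall u, u < v -> m' (L + u.+2) = m (L + u.+2)).
Proof.
elim: r v d m => [|r IH] v d m; rewrite ?addn0 /=.
  move=> vK; rewrite {}vK => Jd mq sd; rewrite expn0 ?muln0 ?addn0 mul1n cats1 cats0.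
  by apply: J_body => //; rewrite -addn1.
move=> vK Jd mq sd; have iotaS j : iota 0 j.+1 = iota 0 j ++ [:: j] by rewrite -addn1 iotaD.
pose I k m' :=
  J (d ++ flatten [seq [seq vals m v ++ x :: t | t <- tuples q r] | x <- iota 0 k]) m' /\
               forall u, u < v -> m' (L + u.+2) = m (L + u.+2).
have I0 : I 0 m by split; rewrite //= cats0.
have := @runs_for L q (q ^ r * (B + 50 * r)) v sideE (nest v.+1 r M) I m _ _ _ _ _ _ _ I0.
move=> H; apply: runs_weaken (H _ _ _ _ _ _ _) _ _ => {H}.
- by move=> k m' [/J_inv[? h0 ?] _]; split; rewrite //= h0.
- move=> k m' x xq [Jm' e']; split; first by apply: J_upd => //; lia.
  by move=> u uv; rewrite update_ne ?e' //; apply/eqP; lia.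
- move=> k m' kq [Jm' e'] mv.
  have mq' u : u < v.+1 -> m' (L + u.+2) < q.
    by rewrite ltnS leq_eqVlt => /predU1P[->|uv]; rewrite ?mv ?e' ?mq.
  have := IH v.+1 _ _ _ Jm' mq'; rewrite addSnnS => /(_ vK) H.
  apply: runs_weaken (H _) (leqnn _) _ => {H}.
    rewrite size_cat (size_allpairs (fun x t => vals m v ++ x :: t)) size_iota size_tuples.
    by move: sd; rewrite expnS; nia.
  move=> m2 [Jm2 e2]; split; last by rewrite e2.
  split; last by move=> u uv; rewrite e2 ?e' //; lia.
  rewrite iotaS map_cat flatten_cat /= cats0 catA.
  congr (J _ m2): Jm2; congr (_ ++ _); apply: eq_map => t.
  rewrite -cat_rcons; congr (_ ++ _); rewrite /vals /mkseq iotaS map_cat /= mv cats1.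
  by congr rcons; apply/eq_in_map => u; rewrite mem_iota => uv; apply: e'.
- lia.
- by rewrite /small /=; lia.
- by [].
- by rewrite addn1.
- have : 0 < q ^ r by rewrite expn_gt0 addn1.
  rewrite expnS; nia.
- move=> m' [Jm' e']; split=> //; congr (J _ m'): Jm'; congr (_ ++ _).
  rewrite map_flatten -map_comp; congr flatten; apply: eq_map => x /=.
  by rewrite -map_comp.
Qed.

Lemma runs_nest m : J [::] m ->
  runs W (nest 0 K M) m (q ^ K * (B + 50 * K)) (J (tuples q K)).
Proof.
move=> Jm; apply: runs_weaken (runs_nest_from (add0n K) Jm _ _) (leqnn _) _ => // m' [].
by move=> Jm' _; congr (J _ m'): Jm'; rewrite /= map_id.
Qed.
End Nest.
End Runs.

(** * Loops filling a table and listing its entries *)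

(** The cells of variables 0 to 6, in which a nest of loops may leave any value. *)
Definition scratch L a := (L + 2 <= a) && (a < L + 9).

Definition mark c a := Cond c (Write a (Const 1)) Skip.

Definition slot out r := Add out (Add (Mul (Const 3) (get 8)) (Const r)).

Definition emit c out :=
  Cond c (Seq (Write (slot out 0) (get 0)) (Seq (Write (slot out 1) (get 1))
    (Seq (Write (slot out 2) (get 2)) (Write (var 8) (Add (get 8) (Const 1)))))) Skip.

Section Nests.
Variables (W X : nat).
Hypotheses (X11 : 11 < X) (XW : wide W X).
Variables (L p K lo : nat) (m0 : memory) (c : expr) (hit : seq nat -> bool).
Local Notation q := (p + 1).
Hypotheses (K7 : K <= 7) (qX : q < X) (loL : L + 11 <= lo).
Hypotheses (m0_bounded : bounded X m0) (m0p : m0 0 = p) (m0L : m0 1 = L).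

(** What the evaluation of a test may rely on during a nest: below [lo] only the counters and cell
    [L + 10], the number of listed triples, can have changed. *)
Definition same_below (m : memory) :=
  [/\ m 0 = p, m 1 = L, forall a, a < lo -> ~~ scratch L a -> a != L + 10 -> m a = m0 a
    & forall v, v < K -> m (L + v.+2) < q].

Hypothesis c_small : small c.
Hypothesis c_hit : forall m, same_below m -> (eval m c != 0) = hit (vals L m K).

(** Marks are written at or above [lo], while the outcome of the test depends only on the cells
    below and on the counters. The order of the tuples is thus irrelevant, and a cell is marked
    exactly if some hit has it as target. *)
Lemma runs_mark adr (target : seq nat -> nat) :
  small adr ->
  (forall m, same_below m -> hit (vals L m K) ->
     eval m adr = target (vals L m K) /\ lo <= target (vals L m K)) ->
  runs W (nest 0 K (mark c adr)) m0 (q ^ K * (cost c + cost adr + 10 + 50 * K))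
    (fun m => bounded X m /\ forall a, ~~ scratch L a ->
       m a = if has (fun t => hit t && (target t == a)) (tuples q K) then 1 else m0 a).
Proof.
move=> adr_small adr_ok.
pose J d m := [/\ bounded X m, all (fun t => hit t ==> (lo <= target t)) d &
  forall a, ~~ scratch L a ->
    m a = if has (fun t => hit t && (target t == a)) d then 1 else m0 a].
have J_low d m a : J d m -> a < lo -> ~~ scratch L a -> m a = m0 a.
  case=> _ dlo E alo sa; rewrite E //; case: hasP => // -[t td /andP[ht /eqP ta]].
  by have := allP dlo t td; rewrite ht /= ta leqNgt alo.
have J_inv d m : J d m -> [/\ bounded X m, m 0 = p & m 1 = L].
  move=> Jm; have [hm _ _] := Jm.
  by rewrite !(J_low _ _ _ Jm) ?m0p ?m0L //; rewrite /scratch; lia.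
apply: runs_weaken (runs_nest X11 XW (J := J) qX J_inv _ K7 _ _) (leqnn _) _.
- move=> d m v x v7 xq [hm dlo E]; split=> //; first by apply: bounded_update => //; lia.
  move=> a sa; rewrite update_ne ?E //; move: sa; rewrite /scratch; lia.
- move=> d m Jm _ mq; have [hm dlo E] := Jm; have [_ mp mL] := J_inv _ _ Jm.
  have sb : same_below m by split=> // a alo sa _; apply: J_low Jm alo sa.
  apply: (@runs_cond _ _ X11 XW _ _ _ _ (cost adr + 5)) => //; last lia.
  rewrite c_hit //; case: ifP => h; last first.
    apply: runs_skip; first lia.
    split=> //; split=> //; first by rewrite all_rcons h.
    by move=> a sa; rewrite E // has_rcons h.
  have [ea lot] := adr_ok _ sb h.
  apply: (runs_write X11 XW) => //=; first lia; rewrite ea.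
  split; last by move=> v vK; rewrite update_ne //; apply/eqP; lia.
  split; first by apply: bounded_update => //; lia.
    by rewrite all_rcons h lot.
  move=> a sa; rewrite has_rcons h /= eq_sym /update; case: eqP => //= _; exact: E.
- by split.
- by move=> m [hm _ E].
Qed.

(** Variable 8 counts the hits so far and so points behind the list. It fits into a word because
    there are only [q ^ K] tuples. *)
Lemma runs_emit out (K3 : K = 3) : q ^ K < X ->
  (forall r, r < 3 -> small (slot out r)) -> m0 (L + 10) = 0 ->
  (forall m, m 0 = p -> m 1 = L -> eval m out = lo) ->
  runs W (nest 0 K (emit c out)) m0 (q ^ K * (cost c + 3 * cost out + 130 + 50 * K))
    (fun m => let ts := filter hit (tuples q K) in
       [/\ bounded X m, m 0 = p, m 1 = L, m (L + 10) = size ts &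
         forall i r, i < size ts -> r < 3 -> m (lo + (3 * i + r)) = nth 0 (nth [::] ts i) r]).
Proof.
move=> qKX slot_small cnt0 out_lo.
pose J d m := [/\ bounded X m, forall a, a < lo -> ~~ scratch L a -> a != L + 10 -> m a = m0 a,
  m (L + 10) = size (filter hit d) & 
  forall i r, i < size (filter hit d) -> r < 3 ->
    m (lo + (3 * i + r)) = nth 0 (nth [::] (filter hit d) i) r].
have J_inv d m : J d m -> [/\ bounded X m, m 0 = p & m 1 = L].
  by case=> hm E _ _; rewrite !E ?m0p ?m0L // /scratch; lia.
apply: runs_weaken (runs_nest X11 XW (J := J) qX J_inv _ K7 _ _) (leqnn _) _.
- move=> d m v x v7 xq [hm E cE oE]; split=> //; first by apply: bounded_update => //; lia.
  + move=> a alo sa a10; rewrite update_ne ?E //; move: sa; rewrite /scratch; lia.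
  + by rewrite update_ne //; apply/eqP; lia.
  + by move=> i r ir r3; rewrite update_ne ?oE //; apply/eqP; lia.
- move=> d m Jm sd mq; have [hm E cE oE] := Jm; have [_ mp mL] := J_inv _ _ Jm.
  have sb : same_below m by split.
  have cX : (m (L + 10)).+1 < X.
    rewrite cE; apply: leq_ltn_trans qKX; apply: leq_trans sd; rewrite ltnS size_filter.
    exact: count_size.
  apply: (@runs_cond _ _ X11 XW _ _ _ _ (3 * cost out + 110)) => //; last lia.
  rewrite c_hit //; case: ifP => h; last first.
    apply: runs_skip; first lia.
    split=> //; rewrite /J filter_rcons h //.
  set n0 := m (L + 10) in cX.
  have step m1 r x B Q : bounded X m1 -> m1 0 = p -> m1 1 = L -> m1 (L + 10) = n0 -> r < 3 ->
      small x -> cost out + cost x + 20 < B ->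
      Q (update m1 (lo + (3 * n0 + r)) (eval m1 x)) ->
      runs W (Write (slot out r) x) m1 B Q.
    move=> hm1 m1p m1L m1c r3 sx cB q; apply: (runs_write X11 XW) => //; first exact: slot_small.
      by rewrite /=; lia.
    have -> : eval m1 (slot out r) = lo + (3 * n0 + r) by rewrite /= m1L m1c out_lo.
    by [].
  have get_val m1 v : m1 1 = L -> eval m1 (get v) = m1 (L + v.+2) by move=> /= ->.
  have val_lt v : v < 3 -> m (L + v.+2) < X by move=> v3; apply: ltn_trans qX; apply: mq; lia.
  have slot_ne r a : a < lo -> a != lo + (3 * n0 + r) by move=> alo; apply/eqP; lia.
  pose m1 := update m (lo + (3 * n0 + 0)) (m (L + 2)).
  pose m2 := update m1 (lo + (3 * n0 + 1)) (m (L + 3)).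
  pose m3 := update m2 (lo + (3 * n0 + 2)) (m (L + 4)).
  have m1E a : a < lo -> m1 a = m a by move=> alo; rewrite /m1 update_ne ?slot_ne.
  have m2E a : a < lo -> m2 a = m a by move=> alo; rewrite /m2 update_ne ?slot_ne ?m1E.
  have m3E a : a < lo -> m3 a = m a by move=> alo; rewrite /m3 update_ne ?slot_ne ?m2E.
  have hm1 : bounded X m1 by apply: bounded_update; rewrite ?val_lt.
  have hm2 : bounded X m2 by apply: bounded_update; rewrite ?(val_lt 1).
  have hm3 : bounded X m3 by apply: bounded_update; rewrite ?(val_lt 2).
  apply: (@runs_seq _ _ _ _ (cost out + 26) (2 * cost out + 80)); last lia.
  apply: (step) => //; first by rewrite /=; lia.
  rewrite get_val // -/m1.
  apply: (@runs_seq _ _ _ _ (cost out + 26) (cost out + 28 + 26)); last lia.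
  apply: (step) => //; rewrite ?m1E //; try lia; first by rewrite /=; lia.
  rewrite get_val ?m1E //; try lia; rewrite -/m2.
  apply: (@runs_seq _ _ _ _ (cost out + 26) 28); last lia.
  apply: (step) => //; rewrite ?m2E //; try lia; first by rewrite /=; lia.
  rewrite get_val ?m2E //; try lia; rewrite -/m3.
  have m3L : m3 1 = L by rewrite m3E //; lia.
  have m3c : m3 (L + 10) = n0 by rewrite m3E //; lia.
  apply: (runs_write X11 XW) => //=; rewrite m3L m3c.
  split; last by move=> v vK; rewrite update_ne ?m3E //; try lia; apply/eqP; lia.
  rewrite /J filter_rcons h size_rcons; split.
  + by apply: bounded_update => //; lia.
  + by move=> a alo sa a10; rewrite update_ne ?m3E ?E.
  + by rewrite update_eq addn1 /n0 cE.
  move=> i r ir r3; rewrite update_ne; last by apply/eqP; lia.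
  move: ir; rewrite ltnS leq_eqVlt nth_rcons => /predU1P[->|ilt]; last first.
    rewrite ilt /m3 /m2 /m1 !update_ne ?oE //; apply/eqP; lia.
  rewrite ltnn eqxx -cE -/n0.
  rewrite K3; case: r r3 => [|[|[|r]]] // _ /=.
  + by rewrite /m3 update_ne ?/m2 ?update_ne ?/m1 ?update_eq //; apply/eqP; lia.
  + by rewrite /m3 update_ne ?/m2 ?update_eq //; apply/eqP; lia.
  + by rewrite /m3 update_eq.
- by split=> //= ; rewrite cnt0.
- by move=> m Jm; have [? ? ?] := J_inv _ _ Jm; case: Jm.
Qed.

End Nests.

(** * Processing one node of the cotree *)

(** Postfix notation can be read uniquely from its end: the last symbol gives the kind of node, and
    what precedes it determines the right subtree and then the left one. *)
Lemma cotree_code_inj n (t t' : cotree 'I_n) u u' :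
  u ++ cotree_code t = u' ++ cotree_code t' -> u = u' /\ t = t'.
Proof.
elim: t t' u u' => [v|l IHl r IHr|l IHl r IHr] [v'|l' r'|l' r'] u u' /=;
  rewrite ?catA ?cats1 => /rcons_inj [].
- by rewrite !addn2 => -> [/val_inj->].
- by move=> _; rewrite addn2.
- by move=> _; rewrite addn2.
- by move=> _; rewrite addn2.
- by move/IHr => [/IHl[-> ->] ->].
- by [].
- by move=> _; rewrite addn2.
- by [].
- by move/IHr => [/IHl[-> ->] ->].
Qed.

(** A binary tree has one inner node fewer than leaves; this is where the number of nodes becomes
    linear in [n]. *)
Lemma size_cotree_code n (t : cotree 'I_n) : (size (cotree_code t)).+1 = 2 * size (leaves t).
Proof. by elim: t => //= l IHl r IHr; rewrite !size_cat /=; lia. Qed.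

(** Guarantees that the scan of the code has a subtree to handle at every position. *)
Lemma code_suffix n (t : cotree 'I_n) i : i < size (cotree_code t) ->
  exists u (t' : cotree 'I_n), take i.+1 (cotree_code t) = u ++ cotree_code t'.
Proof.
have node (l r : cotree 'I_n) (T : cotree 'I_n) x :
    cotree_code T = cotree_code l ++ cotree_code r ++ [:: x] ->
    (forall i, i < size (cotree_code l) ->
      exists u (t' : cotree 'I_n), take i.+1 (cotree_code l) = u ++ cotree_code t') ->
    (forall i, i < size (cotree_code r) ->
      exists u (t' : cotree 'I_n), take i.+1 (cotree_code r) = u ++ cotree_code t') ->
    forall i, i < size (cotree_code T) ->
      exists u (t' : cotree 'I_n), take i.+1 (cotree_code T) = u ++ cotree_code t'.
  move=> E IHl IHr j; rewrite E !size_cat addn1 => jlt.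
  have [jl|jl] := ltnP j (size (cotree_code l)).
    have [u [t' e]] := IHl j jl; exists u, t'.
    by rewrite -e takel_cat.
  have [jr|jr] := ltnP (j - size (cotree_code l)) (size (cotree_code r)).
    have [u [t' e]] := IHr _ jr; exists (cotree_code l ++ u), t'.
    rewrite take_cat ltnNge (leq_trans jl) //= subSn // takel_cat // e catA //.
  exists [::], T; rewrite E take_oversize // !size_cat /=; lia.
elim: t i => [v|l IHl r IHr|l IHl r IHr] i.
- by case: i => // _; exists [::], (Vertex v).
- exact: (node l r _ 0).
- exact: (node l r _ 1).
Qed.

(* The table of the subtree whose code ends at position [i]; its length is kept
   in cell [L + 11 + i].  The list of triples is written behind the tables. *)
Definition table_address L p i a b c :=
  L + L + 11 + (i * ((p + 1) * ((p + 1) * (p + 1))) + ((a * (p + 1) + b) * (p + 1) + c)).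

Local Notation address := table_address.

(** A triple is read as a three-digit number in base [p + 1], so its offset stays within a table of
    [(p + 1) ^ 3] cells. *)
Lemma address_lt L p i j a b c : i < j -> a < p + 1 -> b < p + 1 -> c < p + 1 ->
  address L p i a b c < address L p j 0 0 0.
Proof.
rewrite /address; move: (p + 1) => q ij aq bq cq.
have h1 : a * q + b < q * q by nia.
have h2 : (a * q + b) * q + c < q * (q * q) by nia.
have : i.+1 * (q * (q * q)) <= j * (q * (q * q)) by rewrite leq_mul2r ij orbT.
by lia.
Qed.

Lemma address_ge L p i a b c : address L p i 0 0 0 <= address L p i a b c.
Proof. by rewrite /address; lia. Qed.

Lemma address_min L p i a b c : L + L + 11 <= address L p i a b c.
Proof. by rewrite /address; lia. Qed.

Lemma address_inj L p i a b c a' b' c' : b < p + 1 -> c < p + 1 -> b' < p + 1 -> c' < p + 1 ->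
  address L p i a b c = address L p i a' b' c' -> [/\ a = a', b = b' & c = c'].
Proof.
rewrite /address; move: (p + 1) => q bq cq bq' cq' /addnI/addnI.
have digits x x' y y' : y < q -> y' < q -> x * q + y = x' * q + y' -> x = x' /\ y = y'.
  move=> yq yq' E; have q0 : 0 < q by lia.
  have := congr1 (divn^~ q) E; have := congr1 (modn^~ q) E.
  by rewrite !modnMDl !modn_small // !divnMDl // !divn_small // !addn0.
by move=> /(digits _ _ _ _ cq cq')[/(digits _ _ _ _ bq bq')[-> ->] ->].
Qed.

Definition tokenE := Read (Add (get 7) (Const 2)).
Definition size_cell i := Add (Add (Read (Const 1)) (Const 11)) i.
Definition table_cell i a b c :=
  Add (Add (Add (Read (Const 1)) (Read (Const 1))) (Const 11))
      (Add (Mul i (Mul sideE (Mul sideE sideE))) (Add (Mul (Add (Mul a sideE) b) sideE) c)).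
Definition rightE := Sub (get 7) (Const 1).
(* In postfix notation the right child ends just before its parent and the left
   child just before the code of the right one. *)
Definition leftE := Sub rightE (Read (size_cell rightE)).
(* Nonzero exactly if [x <= y], as subtraction is truncated. *)
Definition leE x y := Sub (Const 1) (Sub x y).
Definition minE x y := Sub x (Sub x y).
Definition sum3 x y z := Add (Add x y) z.

(** A product is nonzero exactly if all its factors are, so [Mul] serves as conjunction here and in
    the other two node programs. *)
Definition vertexM :=
  Seq (nest 0 3 (mark (Mul (sum3 (get 0) (get 1) (get 2))
                           (leE (sum3 (get 0) (get 1) (get 2)) (Read (Const 0))))
                      (table_cell (get 7) (get 0) (get 1) (get 2))))
      (Write (size_cell (get 7)) (Const 1)).

Definition inner_sizeM :=
  Write (size_cell (get 7))
    (Add (Add (Read (size_cell leftE)) (Read (size_cell rightE))) (Const 1)).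

Definition unionM :=
  Seq (nest 0 4 (mark (Mul (leE (sum3 (get 0) (get 1) (Add (get 2) (get 3))) (Read (Const 0)))
                        (Mul (Read (table_cell leftE (get 0) (get 1) (get 2)))
                             (Read (table_cell rightE (get 0) (get 1) (get 3)))))
                      (table_cell (get 7) (get 0) (get 1) (Add (get 2) (get 3)))))
      inner_sizeM.

(* Counter 6 is the total number of stars: with [s1 <= min z1 y2] of them centred
   on the left and [s2 <= min z2 y1] on the right, the triples [(x1, y1, z1)] and
   [(x2, y2, z2)] combine to one which depends on [s1 + s2] only. *)
Definition joinM :=
  let a := Add (Add (get 0) (get 3)) (get 6) in
  let b := Sub (Add (get 1) (get 4)) (get 6) in
  let c := Sub (Add (get 2) (get 5)) (get 6) in
  Seq (nest 0 7 (mark (Mul (leE (get 6) (Add (minE (get 2) (get 4)) (minE (get 5) (get 1))))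
                        (Mul (leE (sum3 a b c) (Read (Const 0)))
                          (Mul (Read (table_cell leftE (get 0) (get 1) (get 2)))
                               (Read (table_cell rightE (get 3) (get 4) (get 5))))))
                      (table_cell (get 7) a b c)))
      inner_sizeM.

(** Symbol minus one is nonzero just for vertices, whose symbols are at least 2; of the other
    symbols, 1 is a join and 0 a union. *)
Definition tokenM :=
  Cond (Sub tokenE (Const 1)) vertexM (Cond tokenE joinM unionM).

(** * Correctness and cost of one step *)

Section Step.
Variables (W X n L p : nat) (code : seq nat).
Hypotheses (X11 : 11 < X) (XW : wide W X).
Local Notation q := (p + 1).
Local Notation adr := (address L p).
Hypotheses (qX : q < X) (LX : L < X) (codeL : size code = L).

Definition table_ok (m : memory) i (t : cotree 'I_n) := forall a b c, a < q -> b < q -> c < q ->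
  (m (adr i a b c) != 0) <-> a + b + c <= p /\ admitted t a b c.

(** All readings of the code up to [i] as ending in a cotree are covered; by [cotree_code_inj] there
    is at most one. *)
Definition processed (m : memory) i := forall u (t : cotree 'I_n),
  take i.+1 code = u ++ cotree_code t ->
  m (L + 11 + i) = size (cotree_code t) /\ table_ok m i t.

(** From table [i] on the memory is still zero, so a step only has to write the marks. Nothing is
    said about the counters and the position, which are free to change. *)
Definition Inv i m :=
  [/\ [/\ bounded X m, m 0 = p & m 1 = L], forall j, j < L -> m (j + 2) = nth 0 code j,
      m (L + 10) = 0, forall a, adr i 0 0 0 <= a -> m a = 0
    & forall j, j < i -> processed m j].

Lemma Inv_advance i m m1 (hit : seq nat -> bool) target K u (t : cotree 'I_n) :
  Inv i m -> i < L -> take i.+1 code = u ++ cotree_code t ->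
  bounded X m1 ->
  (forall a, ~~ scratch L a ->
     m1 a = if has (fun s => hit s && (target s == a)) (tuples q K) then 1 else m a) ->
  (forall s, s \in tuples q K -> hit s -> exists a b c,
     [/\ a < q, b < q, c < q & target s = adr i a b c]) ->
  (forall a b c, a < q -> b < q -> c < q ->
     (exists s, [/\ s \in tuples q K, hit s & target s = adr i a b c]) <->
     a + b + c <= p /\ admitted t a b c) ->
  Inv i.+1 (update m1 (L + 11 + i) (size (cotree_code t))).
Proof.
case=> [[hm mp mL] mcode m10 m0 mproc] iL tk hm1 E target_in target_ok.
have codeX : size (cotree_code t) < X.
  have : size (take i.+1 code) <= L by rewrite size_take_min codeL geq_minr.
  by rewrite tk size_cat; lia.
have outside a : ~~ scratch L a -> a < adr i 0 0 0 \/ adr i.+1 0 0 0 <= a -> m1 a = m a.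
  move=> sa out; rewrite E //; case: hasP => // -[s sin /andP[hs /eqP ts]].
  have [a' [b' [c' [aq bq cq te]]]] := target_in s sin hs.
  have := @address_lt L p i i.+1 a' b' c' (ltnSn i) aq bq cq.
  by have := @address_ge L p i a' b' c'; rewrite -te ts; lia.
have lowadr := @address_min L p i 0 0 0.
have low a : ~~ scratch L a -> a < L + L + 11 -> m1 a = m a.
  by move=> sa al; apply: outside => //; left; lia.
have nadr j a b c : adr j a b c != L + 11 + i.
  by have := @address_min L p j a b c; move=> ?; apply/eqP; lia.
have nsadr j a b c : ~~ scratch L (adr j a b c).
  by have := @address_min L p j a b c; rewrite /scratch; lia.
split.
- split; first exact: bounded_update.
  + by rewrite update_ne ?low //; rewrite ?/scratch; lia.
  + by rewrite update_ne ?low //; rewrite ?/scratch; lia.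
- move=> j jL; rewrite update_ne ?low ?mcode //; rewrite ?/scratch; lia.
- by rewrite update_ne ?low //; rewrite ?/scratch; lia.
- move=> a ha; have := @address_lt L p i i.+1 0 0 0 (ltnSn i).
  rewrite addn1 => /(_ isT isT isT) lt1.
  rewrite update_ne; last by apply/eqP; lia.
  by rewrite outside ?m0 //; [lia | rewrite /scratch; lia | right].
move=> j; rewrite ltnS leq_eqVlt => /predU1P[->|ji] u' t' tk'.
  (* Unique reading: the subtree ending at [i] is the one just treated. *)
  have [_ <-] := cotree_code_inj (etrans (esym tk) tk').
  split; first by rewrite update_eq.
  move=> a b c aq bq cq; rewrite update_ne // E //.
  rewrite m0; last exact: address_ge.
  rewrite -target_ok //; split.
    by case: hasP => // -[s sin /andP[hs /eqP ts]] _; exists s.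
  case=> s [sin hs ts]; case: hasP => // -[]; exists s => //.
  by rewrite hs ts /=.
have [sz tab] := mproc j ji u' t' tk'; split.
  by rewrite update_ne ?low //; rewrite ?/scratch; lia.
move=> a b c aq bq cq; rewrite update_ne // outside ?tab //.
by left; apply: address_lt.
Qed.

Lemma leE_neq0 x y : (1 - (x - y) != 0) = (x <= y).
Proof. by apply/idP/idP; lia. Qed.

Lemma runs_table i m K c adrE sizeE hit target B u (t : cotree 'I_n) :
  Inv i m -> i < L -> m (L + 9) = i -> take i.+1 code = u ++ cotree_code t ->
  K <= 7 -> small c -> small adrE -> small sizeE ->
  (forall m1, same_below L p K (adr i 0 0 0) m m1 -> (eval m1 c != 0) = hit (vals L m1 K)) ->
  (forall m1, same_below L p K (adr i 0 0 0) m m1 -> hit (vals L m1 K) ->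
     eval m1 adrE = target (vals L m1 K)) ->
  (forall s, s \in tuples q K -> hit s -> exists a b c,
     [/\ a < q, b < q, c < q & target s = adr i a b c]) ->
  (forall a b c, a < q -> b < q -> c < q ->
     (exists s, [/\ s \in tuples q K, hit s & target s = adr i a b c]) <->
     a + b + c <= p /\ admitted t a b c) ->
  (forall m1, (forall a, a < adr i 0 0 0 -> ~~ scratch L a -> m1 a = m a) ->
     eval m1 sizeE = size (cotree_code t)) ->
  q ^ K * (cost c + cost adrE + 10 + 50 * K) + cost sizeE + 20 <= B ->
  runs W (Seq (nest 0 K (mark c adrE)) (Write (size_cell (get 7)) sizeE)) m B
    (fun m' => Inv i.+1 m' /\ m' (L + 9) = i).
Proof.
move=> inv iL m9 tk K7 sc sa ss c_hit adr_hit target_in target_ok size_ok BB.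
have [[hm mp mL] _ _ _ _] := inv.
have lowadr := @address_min L p i 0 0 0.
apply: (@runs_seq _ _ _ _ (q ^ K * (cost c + cost adrE + 10 + 50 * K)) (cost sizeE + 20));
  last lia.
apply: runs_weaken (@runs_mark _ _ X11 XW L p K (adr i 0 0 0) m c hit K7 qX _ hm mp mL sc c_hit
  adrE target sa _) (leqnn _) _; first lia.
  move=> m1 sb h; split; first exact: adr_hit.
  have [|a [b [c' [_ _ _ ->]]]] := target_in (vals L m1 K) _ h; last exact: address_ge.
  have [_ _ _ mq] := sb; rewrite mem_tuples size_mkseq eqxx /=; apply/allP => x.
  by case/mapP => v; rewrite mem_iota => /andP[_ vK] ->; apply: mq.
move=> m1 [hm1 E].
have low a : a < adr i 0 0 0 -> ~~ scratch L a -> m1 a = m a.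
  move=> al sa'; rewrite E //; case: hasP => // -[s sin /andP[hs /eqP ts]].
  have [a' [b' [c' [_ _ _ te]]]] := target_in s sin hs.
  by have := @address_ge L p i a' b' c'; rewrite -te ts; lia.
apply: (runs_write X11 XW) => //; first by rewrite /=; lia.
have -> : eval m1 (size_cell (get 7)) = L + 11 + i.
  by rewrite /= !low ?mL ?m9 ?/scratch; lia.
rewrite size_ok //; split; first exact: Inv_advance inv iL tk hm1 E target_in target_ok.
by rewrite update_ne ?low ?m9 ?/scratch; lia.
Qed.

Lemma token_split i u s x : i < L -> take i.+1 code = u ++ s ++ [:: x] ->
  nth 0 code i = x /\ take i code = u ++ s.
Proof.
by rewrite -codeL => iL; rewrite (take_nth 0) // catA cats1 => /rcons_inj[-> ->].
Qed.

Lemma children i m u (l r : cotree 'I_n) : Inv i m -> i < L ->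
  take i code = u ++ cotree_code l ++ cotree_code r ->
  [/\ 0 < i, m (L + 11 + (i - 1)) = size (cotree_code r), table_ok m (i - 1) r
   & let j := i - 1 - size (cotree_code r) in
     [/\ j < i, m (L + 11 + j) = size (cotree_code l), table_ok m j l &
         size (cotree_code l) + size (cotree_code r) < L]].
Proof.
case=> [_ _ _ _ mproc] iL tk.
have sl := size_cotree_code l; have sr := size_cotree_code r.
(* Codes are nonempty, so none of the subtractions locating the children is truncated. *)
have leaves_gt0 (t : cotree 'I_n) : 0 < size (leaves t).
  by elim: t => //= t1 h1 t2 h2; rewrite size_cat; lia.
have := leaves_gt0 l; have := leaves_gt0 r => r0 l0.
have si : i = size u + size (cotree_code l) + size (cotree_code r).
  by have := congr1 size tk; rewrite size_takel ?codeL ?(ltnW iL) // !size_cat addnA.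
have i0 : 0 < i by lia.
have i1 : (i - 1).+1 = i by lia.
have ti : take (i - 1).+1 code = (u ++ cotree_code l) ++ cotree_code r by rewrite i1 tk catA.
have [|szr tabr] := mproc (i - 1) _ _ _ ti; first by lia.
split=> //=; set j := _ - _.
have jE : j.+1 = size (u ++ cotree_code l) by rewrite size_cat; lia.
have tj : take j.+1 code = u ++ cotree_code l.
  by rewrite -(@take_takel _ _ i) ?tk ?catA ?jE ?take_size_cat // size_cat; lia.
have [|szl tabl] := mproc j _ _ _ tj; first by lia.
by split=> //; lia.
Qed.

(** One constant for all kinds of nodes, covering test, mark, the overhead of up to seven loops and
    the computation of the size. *)
Definition nest_cost := 2000.

Lemma runs_vertex i m u (v : 'I_n) : Inv i m -> i < L -> m (L + 9) = i ->
  take i.+1 code = u ++ cotree_code (Vertex v) ->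
  runs W vertexM m (q ^ 3 * nest_cost) (fun m' => Inv i.+1 m' /\ m' (L + 9) = i).
Proof.
move=> inv iL m9 tk; have lowadr := @address_min L p i 0 0 0.
pose w (s : seq nat) := nth 0 s 0 + nth 0 s 1 + nth 0 s 2.
have m1_9 K m1 : same_below L p K (adr i 0 0 0) m m1 -> m1 (L + 9) = i.
  by case=> _ _ E _; rewrite E // /scratch; lia.
apply: (@runs_table i m 3 _ _ _ (fun s => (0 < w s) && (w s <= p))
   (fun s => adr i (nth 0 s 0) (nth 0 s 1) (nth 0 s 2)) _ u (Vertex v)) => //.
- move=> m1 sb; have [m1p m1L _ _] := sb.
  by rewrite /= m1p m1L muln_eq0 negb_or leE_neq0 -lt0n.
- by move=> m1 sb _; have := m1_9 _ _ sb; have [m1p m1L _ _] := sb; rewrite /= m1p m1L => ->.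
- case=> [|x [|y [|z [|? ?]]]]; rewrite mem_tuples //= => /and4P[xq yq zq _] _.
  by exists x, y, z.
- move=> a b c aq bq cq; split.
    case=> s [+ + te]; rewrite mem_tuples /w.
    case: s te => [|x [|y [|z [|? ?]]]] te //= /and4P[xq yq zq _].
    by have [/= <- <- <-] := address_inj yq zq bq cq te; case/andP.
  by case=> wp w0; exists [:: a; b; c]; rewrite mem_tuples /= aq bq cq /w /= w0 wp.
- rewrite /nest_cost /=; have : 0 < q ^ 3 by rewrite expn_gt0 addn1.
  nia.
Qed.

Lemma eval_Mul m x y : eval m (Mul x y) = eval m x * eval m y.
Proof. by []. Qed.

Lemma eval_table_cell m k a b c : m 0 = p -> m 1 = L ->
  eval m (table_cell k a b c) = adr (eval m k) (eval m a) (eval m b) (eval m c).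
Proof. by move=> mp mL; rewrite /= mp mL. Qed.

Lemma eval_Read_table_cell m k a b c : m 0 = p -> m 1 = L ->
  eval m (Read (table_cell k a b c)) = m (adr (eval m k) (eval m a) (eval m b) (eval m c)).
Proof. by move=> mp mL; rewrite -eval_table_cell. Qed.

Lemma eval_get m v : m 1 = L -> eval m (get v) = m (L + v.+2).
Proof. by move=> /= ->. Qed.

Section Inner.
Variables (i : nat) (m : memory) (u : seq nat) (l r T : cotree 'I_n) (x : nat).
Hypotheses (inv : Inv i m) (iL : i < L) (m9 : m (L + 9) = i).
Hypothesis codeT : cotree_code T = cotree_code l ++ cotree_code r ++ [:: x].
Hypothesis tk : take i.+1 code = u ++ cotree_code T.

Local Notation j := (i - 1 - size (cotree_code r)).

Lemma inner_children :
  [/\ 0 < i, m (L + 11 + (i - 1)) = size (cotree_code r), table_ok m (i - 1) r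
   & [/\ j < i, m (L + 11 + j) = size (cotree_code l), table_ok m j l &
         size (cotree_code l) + size (cotree_code r) < L]].
Proof.
apply: (children inv iL (u := u)).
have := tk; rewrite codeT [cotree_code l ++ _]catA.
by move=> /(token_split iL)[_ ->].
Qed.

Lemma inner_low m1 K : same_below L p K (adr i 0 0 0) m m1 ->
  [/\ m1 0 = p, m1 1 = L, m1 (L + 9) = i, eval m1 leftE = j &
    forall k a b c, k < i -> a < q -> b < q -> c < q -> m1 (adr k a b c) = m (adr k a b c)].
Proof.
move=> [m1p m1L E mq]; have [i0 szr _ _] := inner_children.
have lowadr := @address_min L p i 0 0 0.
have m19 : m1 (L + 9) = i by rewrite E // /scratch; lia.
split=> // [|k a b c ki aq bq cq].
  by rewrite /= !m1L !m19 E ?szr //; rewrite /scratch; lia.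
have := @address_min L p k a b c => ?.
rewrite E //; last by apply/eqP; lia.
- exact: address_lt.
- by rewrite /scratch; lia.
Qed.

Lemma inner_size m1 : (forall a, a < adr i 0 0 0 -> ~~ scratch L a -> m1 a = m a) ->
  eval m1 (Add (Add (Read (size_cell leftE)) (Read (size_cell rightE))) (Const 1)) =
  size (cotree_code T).
Proof.
move=> E; have [i0 szr _ [ji szl _ _]] := inner_children.
have lowadr := @address_min L p i 0 0 0.
have [[_ _ mL] _ _ _ _] := inv.
have m1L : m1 1 = L by rewrite E // /scratch; lia.
have m19 : m1 (L + 9) = i by rewrite E // /scratch; lia.
have m1r : m1 (L + 11 + (i - 1)) = size (cotree_code r) by rewrite E ?szr // /scratch; lia.
have m1l : m1 (L + 11 + j) = size (cotree_code l) by rewrite E ?szl // /scratch; lia.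
by rewrite /= !m1L !m19 !m1r m1l codeT !size_cat /=; lia.
Qed.
End Inner.

Lemma runs_union i m u (l r : cotree 'I_n) : Inv i m -> i < L -> m (L + 9) = i ->
  take i.+1 code = u ++ cotree_code (DisjointUnion l r) ->
  runs W unionM m (q ^ 4 * nest_cost) (fun m' => Inv i.+1 m' /\ m' (L + 9) = i).
Proof.
move=> inv iL m9 tk.
have codeT : cotree_code (DisjointUnion l r) = cotree_code l ++ cotree_code r ++ [:: 0] by [].
have [i0 _ tabr [ji _ tabl _]] := inner_children inv iL codeT tk.
set j := i - 1 - _ in ji tabl.
have i1 : i - 1 < i by lia.
pose hit (s : seq nat) := (nth 0 s 0 + nth 0 s 1 + (nth 0 s 2 + nth 0 s 3) <= p) &&
  ((m (adr j (nth 0 s 0) (nth 0 s 1) (nth 0 s 2)) != 0) &&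
   (m (adr (i - 1) (nth 0 s 0) (nth 0 s 1) (nth 0 s 3)) != 0)).
apply: (@runs_table i m 4 _ _ _ hit
   (fun s => adr i (nth 0 s 0) (nth 0 s 1) (nth 0 s 2 + nth 0 s 3))
   _ u (DisjointUnion l r)) => //.
- move=> m1 sb; have [m1p m1L m19 leftv tabs] := inner_low inv iL m9 codeT tk sb.
  have [_ _ _ mq] := sb.
  rewrite !eval_Mul !eval_Read_table_cell // leftv !eval_get // !muln_eq0 !negb_or.
  by rewrite /hit /vals /= m1p !m1L m19 leE_neq0 !tabs // ?(mq 0) ?(mq 1) ?(mq 2) ?(mq 3).
- move=> m1 sb _; have [m1p m1L m19 _ _] := inner_low inv iL m9 codeT tk sb.
  by rewrite /= m1p m1L m19.
- case=> [|x [|y [|z1 [|z2 [|? ?]]]]]; rewrite mem_tuples //= => /and5P[xq yq zq1 zq2 _].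
  by rewrite /hit /= => /andP[w _]; exists x, y, (z1 + z2); split=> //; lia.
- move=> a b c aq bq cq; split.
    case=> s [+ + te]; rewrite mem_tuples /hit.
    case: s te => [|x [|y [|z1 [|z2 [|? ?]]]]] te //= /and5P[xq yq zq1 zq2 _].
    case/and3P=> wp /(tabl x y z1 xq yq zq1)[_ hl] /(tabr x y z2 xq yq zq2)[_ hr].
    have zq : z1 + z2 < q by lia.
    have [/= <- <- <-] := address_inj yq zq bq cq te; split=> //.
    by exists z1, z2.
  case=> wp [c1 [c2 [cE hl hr]]]; exists [:: a; b; c1; c2].
  have c1q : c1 < q by lia.
  have c2q : c2 < q by lia.
  rewrite mem_tuples /hit /= aq bq c1q c2q -cE wp; split=> //=.
  apply/andP; split; first by apply/(tabl _ _ _ aq bq c1q); split=> //; lia.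
  by apply/(tabr _ _ _ aq bq c2q); split=> //; lia.
- by move=> m1 E; apply: (inner_size inv iL m9 codeT tk E).
- rewrite /nest_cost /=; have : 0 < q ^ 4 by rewrite expn_gt0 addn1.
  nia.
Qed.

(** Each star is counted among the colour classes of one child and among the removed vertices of the
    other. So the number [s] of stars is added to the sum of the first components and subtracted
    once from each of the two other sums. *)
Lemma runs_join i m u (l r : cotree 'I_n) : Inv i m -> i < L -> m (L + 9) = i ->
  take i.+1 code = u ++ cotree_code (Join l r) ->
  runs W joinM m (q ^ 7 * nest_cost) (fun m' => Inv i.+1 m' /\ m' (L + 9) = i).
Proof.
move=> inv iL m9 tk.
have codeT : cotree_code (Join l r) = cotree_code l ++ cotree_code r ++ [:: 1] by [].
have [i0 _ tabr [ji _ tabl _]] := inner_children inv iL codeT tk.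
set j := i - 1 - _ in ji tabl.
have i1 : i - 1 < i by lia.
pose wa (s : seq nat) := nth 0 s 0 + nth 0 s 3 + nth 0 s 6.
pose wb (s : seq nat) := nth 0 s 1 + nth 0 s 4 - nth 0 s 6.
pose wc (s : seq nat) := nth 0 s 2 + nth 0 s 5 - nth 0 s 6.
pose hit (s : seq nat) :=
  (nth 0 s 6 <= nth 0 s 2 - (nth 0 s 2 - nth 0 s 4) + (nth 0 s 5 - (nth 0 s 5 - nth 0 s 1))) &&
  ((wa s + wb s + wc s <= p) &&
  ((m (adr j (nth 0 s 0) (nth 0 s 1) (nth 0 s 2)) != 0) &&
   (m (adr (i - 1) (nth 0 s 3) (nth 0 s 4) (nth 0 s 5)) != 0))).
apply: (@runs_table i m 7 _ _ _ hit (fun s => adr i (wa s) (wb s) (wc s)) _ u (Join l r)) => //.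
- move=> m1 sb; have [m1p m1L m19 leftv tabs] := inner_low inv iL m9 codeT tk sb.
  have [_ _ _ mq] := sb.
  rewrite !eval_Mul !eval_Read_table_cell // leftv !eval_get // !muln_eq0 !negb_or.
  rewrite /hit /vals /= m1p !m1L m19 !leE_neq0.
  by rewrite !tabs // ?(mq 0) ?(mq 1) ?(mq 2) ?(mq 3) ?(mq 4) ?(mq 5).
- move=> m1 sb _; have [m1p m1L m19 _ _] := inner_low inv iL m9 codeT tk sb.
  by rewrite eval_table_cell //= !m1L m19.
- move=> s _ /and3P[_ w _]; exists (wa s), (wb s), (wc s); split=> //; lia.
- move=> a b c aq bq cq; split.
    case=> s [+ + te]; rewrite mem_tuples /hit.
    case: s te => [|x1 [|y1 [|z1 [|x2 [|y2 [|z2 [|s [|? ?]]]]]]]] te //=.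
    move=> /and5P[xq1 yq1 zq1 xq2 /and4P[yq2 zq2 _ _]].
    case/and4P=> sle wp /(tabl x1 y1 z1 xq1 yq1 zq1)[_ hl] /(tabr x2 y2 z2 xq2 yq2 zq2)[_ hr].
    move: te wp; rewrite /wa /wb /wc /= => te wp.
    have [||/= <- <- <-] := address_inj _ _ bq cq te; try lia.
    split=> //.
    have [s1 [s2 [sE h1 h2 h3 h4]]] : exists s1 s2,
        [/\ s = s1 + s2, s1 <= z1, s1 <= y2, s2 <= z2 & s2 <= y1].
      (* Greedy split: as many stars as possible are centred on the left, and the tested bound on
         [s] leaves at most [minn z2 y1] for the right. *)
      by exists (minn s (minn z1 y2)), (s - minn s (minn z1 y2)); split; lia.
    exists x1, x2, (y1 - s2), (y2 - s1), (z1 - s1), (z2 - s2), s1, s2.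
    rewrite !subnK //; split=> //; clear - sE h1 h2 h3 h4.
    by split; lia.
  case=> wp [a1 [a2 [b1 [b2 [c1 [c2 [s1 [s2 [[aE bE cE] hl hr]]]]]]]]].
  (* The stars contained in [a] pay for the additional [s1] and [s2], so both children have triples
     of weight at most [p]. *)
  have ql : [/\ a1 < q, b1 + s2 < q & c1 + s1 < q] by split; lia.
  have qr : [/\ a2 < q, b2 + s1 < q & c2 + s2 < q] by split; lia.
  case: ql => ql1 ql2 ql3; case: qr => qr1 qr2 qr3.
  exists [:: a1; b1 + s2; c1 + s1; a2; b2 + s1; c2 + s2; s1 + s2].
  have sq : s1 + s2 < q by lia.
  rewrite mem_tuples /hit /wa /wb /wc /= ql1 ql2 ql3 qr1 qr2 qr3 sq; split=> //.
    apply/and4P; split; [lia | lia | |].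
      by apply/(tabl _ _ _ ql1 ql2 ql3); split=> //; lia.
    by apply/(tabr _ _ _ qr1 qr2 qr3); split=> //; lia.
  by congr (adr i _ _ _); lia.
- by move=> m1 E; apply: (inner_size inv iL m9 codeT tk E).
- rewrite /nest_cost /=; have : 0 < q ^ 7 by rewrite expn_gt0 addn1.
  nia.
Qed.

Lemma runs_token i m u (t : cotree 'I_n) : Inv i m -> i < L -> m (L + 9) = i ->
  take i.+1 code = u ++ cotree_code t ->
  runs W tokenM m (q ^ 7 * nest_cost + 50) (fun m' => Inv i.+1 m' /\ m' (L + 9) = i).
Proof.
move=> inv iL m9 tk; have [[hm mp mL] mcode _ _ _] := inv.
have tokv : eval m tokenE = nth 0 code i by rewrite /= mL m9 mcode.
have pow k : k <= 7 -> q ^ k * nest_cost <= q ^ 7 * nest_cost.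
  by move=> k7; rewrite leq_mul2r leq_pexp2l ?orbT // addn1.
apply: (runs_cond X11 XW (B := q ^ 7 * nest_cost + 30)) => //; last by rewrite /=; lia.
rewrite [eval m (Sub _ _)]/(eval m tokenE - 1) tokv.
case: t tk => [v|l r|l r] tk.
- have [-> _] := token_split (s := [::]) iL tk.
  rewrite (_ : v + 2 - 1 != 0); last lia.
  by apply: runs_weaken (runs_vertex inv iL m9 tk) _ _ => //; have := pow 3 isT; lia.
- have tk' : take i.+1 code = u ++ (cotree_code l ++ cotree_code r) ++ [:: 0].
    by rewrite tk /= -catA.
  have [x0 _] := token_split iL tk'; rewrite x0 /=.
  apply: (runs_cond X11 XW (B := q ^ 7 * nest_cost)) => //; last by rewrite /=; lia.
  rewrite tokv x0 /=; apply: runs_weaken (runs_union inv iL m9 tk) _ _ => //; exact: pow.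
- have tk' : take i.+1 code = u ++ (cotree_code l ++ cotree_code r) ++ [:: 1].
    by rewrite tk /= -catA.
  have [x1 _] := token_split iL tk'; rewrite x1 /=.
  apply: (runs_cond X11 XW (B := q ^ 7 * nest_cost)) => //; last by rewrite /=; lia.
  by rewrite tokv x1 /=; apply: runs_join inv iL m9 tk.
Qed.

End Step.

(** * The whole program *)

Definition rootE := table_cell (Sub (Read (Const 1)) (Const 1)) (get 0) (get 1) (get 2).
(** Position [L] would come right after the root, so this is the first cell behind all tables. *)
Definition outputE := table_cell (Read (Const 1)) (Const 0) (Const 0) (Const 0).

(** The order of the last two writes matters: [outputE] needs [p] in cell 0 and [L] in cell 1, and
    [get 8] still finds its variable through cell 1. *)
Definition mainM :=
  Seq (For 7 (Read (Const 1)) tokenM)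
    (Seq (nest 0 3 (emit (Read rootE) outputE))
      (Seq (Write (Const 0) outputE) (Write (Const 1) (get 8)))).

Lemma cotree_code_lt n (t : cotree 'I_n) x : x \in cotree_code t -> x < n + 2.
Proof.
elim: t => [v|l IHl r IHr|l IHl r IHr] /=.
- by rewrite inE => /eqP->; have := ltn_ord v; lia.
- by rewrite !mem_cat inE => /or3P[/IHl|/IHr|/eqP->] //; lia.
- by rewrite !mem_cat inE => /or3P[/IHl|/IHr|/eqP->] //; lia.
Qed.

Section Main.
Variables (W X n p : nat) (t : cotree 'I_n).
Local Notation q := (p + 1).
Local Notation code := (cotree_code t).
Local Notation L := (size code).
Local Notation adr := (address L p).
Hypotheses (X11 : 11 < X) (XW : wide W X) (nX : n + 2 < X) (qX : q < X) (LX : L < X).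
Hypotheses (q3X : q ^ 3 < X) (outX : adr L 0 0 0 < X).

Lemma input_cell j : input p t j.+2 = nth 0 code j.
Proof. by []. Qed.

Lemma Inv_input : Inv X n L p code 0 (input p t).
Proof.
split=> //.
- split=> // -[|[|j]]; rewrite /input //=; first lia.
  have [jL|jL] := ltnP j L; last by rewrite nth_default //; lia.
  by apply: ltn_trans nX; apply: cotree_code_lt (mem_nth 0 jL).
- by move=> j jL; rewrite addn2.
- by rewrite (_ : L + 10 = (L + 8).+2) ?input_cell ?nth_default //; lia.
- move=> a ha; have {ha} a_ge : L + 11 <= a by move: ha; rewrite /address; lia.
  by rewrite (_ : a = a.-2.+2) ?input_cell ?nth_default //; lia.
Qed.

Lemma Inv_update i m x : x <= L -> Inv X n L p code i m ->
  Inv X n L p code i (update m (L + 9) x).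
Proof.
move=> xL [[hm mp mL] mcode m10 m0 mproc].
split.
- split; first by apply: bounded_update => //; lia.
  + by rewrite update_ne //; apply/eqP; lia.
  + by rewrite update_ne //; apply/eqP; lia.
- by move=> j jL; rewrite update_ne ?mcode //; apply/eqP; lia.
- by rewrite update_ne //; apply/eqP; lia.
- move=> a ha; rewrite update_ne ?m0 //; apply/eqP; move: ha; rewrite /address; lia.
move=> j ji u t' tk; have [sz tab] := mproc j ji u t' tk; split.
  by rewrite update_ne //; apply/eqP; lia.
move=> a b c aq bq cq; rewrite update_ne ?tab //.
have := @address_min L p j a b c => ?; apply/eqP; lia.
Qed.

Lemma runs_tokens :
  runs W (For 7 (Read (Const 1)) tokenM) (input p t) (L * (q ^ 7 * nest_cost + 50 + 50))
    (Inv X n L p code L).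
Proof.
apply: (@runs_for _ _ X11 XW L L (q ^ 7 * nest_cost + 50) 7 _ _ (Inv X n L p code)) => //.
- by move=> k m [[hm mp mL] _ _ _ _]; split.
- by move=> k m x xL; apply: Inv_update.
- move=> k m kL inv m9; have [u [t' tk]] := code_suffix kL.
  exact: (runs_token X11 XW qX LX erefl inv kL m9 tk).
- by have := size_cotree_code t; case: t => //= l r; rewrite !size_cat /=; lia.
- exact: Inv_input.
Qed.

Lemma runs_main B :
  L * (q ^ 7 * nest_cost + 100) + q ^ 3 * 1000 + 200 <= B ->
  runs W mainM (input p t) B (fun m => uniq (output m) /\
    forall a b c, (a, b, c) \in output m <-> a + b + c <= p /\ admitted t a b c).
Proof.
move=> BB.
have L0 : 0 < L by case: t => //= l r; rewrite !size_cat /=; lia.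
apply: (@runs_seq _ _ _ _ (L * (q ^ 7 * nest_cost + 50 + 50)) (q ^ 3 * 1000 + 200));
  last by rewrite -addnA in BB; lia.
apply: runs_weaken runs_tokens (leqnn _) _ => m [[hm mp mL] _ m10 _ mproc].
have L1 : (L - 1).+1 = L by lia.
have tk : take (L - 1).+1 code = [::] ++ code by rewrite L1 take_size.
have [|_ tab] := mproc (L - 1) _ _ _ tk; first lia.
pose hit (s : seq nat) := m (adr (L - 1) (nth 0 s 0) (nth 0 s 1) (nth 0 s 2)) != 0.
apply: (@runs_seq _ _ _ _ (q ^ 3 * 1000) 200) => //.
have low := @address_min L p L 0 0 0.
apply: runs_weaken (@runs_emit _ _ X11 XW L p 3 (adr L 0 0 0) m (Read rootE) hit
  isT qX _ hm mp mL isT _ outputE erefl q3X _ m10 _) _ _.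
- by lia.
- move=> m1 [m1p m1L E mq]; rewrite (@eval_Read_table_cell L p m1 _ _ _ _ m1p m1L).
  rewrite !(eval_get _ m1L) /= m1L /hit /=.
  rewrite E //.
  + by apply: address_lt; rewrite ?mq //; lia.
  + have := @address_min L p (L - 1) (m1 (L + 2)) (m1 (L + 3)) (m1 (L + 4)).
    by rewrite /scratch; lia.
  + have := @address_min L p (L - 1) (m1 (L + 2)) (m1 (L + 3)) (m1 (L + 4)) => ?.
    by apply/eqP; lia.
- by case=> [|[|[|r]]].
- by move=> m1 m1p m1L; rewrite (@eval_table_cell L p m1 _ _ _ _ m1p m1L) /= m1L.
- by rewrite leq_mul2l; apply/orP; right.
set ts := filter hit _ => m1 [hm1 m1p m1L m1c m1o].
apply: (@runs_seq _ _ _ _ 100 100) => //.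
have outE m' : m' 0 = p -> m' 1 = L -> eval m' outputE = adr L 0 0 0.
  by move=> m'p m'L; rewrite (@eval_table_cell L p m' _ _ _ _ m'p m'L) /= m'L.
apply: (runs_write X11 XW) => //; rewrite outE // [eval _ (Const 0)]/=.
apply: (runs_write X11 XW) => //; first exact: bounded_update.
rewrite (@eval_get L); last by rewrite update_ne.
rewrite [eval _ (Const 1)]/= update_ne; last by apply/eqP; lia.
rewrite m1c; set mf := update _ _ _.
have mf0 : mf 0 = adr L 0 0 0 by [].
have mf1 : mf 1 = size ts by [].
have mfo i r : i < size ts -> r < 3 -> mf (adr L 0 0 0 + (3 * i + r)) = nth 0 (nth [::] ts i) r.
  by move=> its r3; rewrite /mf !update_ne ?m1o //; apply/eqP; lia.
have outE' : output mf = [seq (nth 0 s 0, nth 0 s 1, nth 0 s 2) | s <- ts].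
  rewrite /output mf0 mf1 -[in RHS](mkseq_nth [::] ts) /mkseq -map_comp.
  apply/eq_in_map => i; rewrite mem_iota add0n => /andP[_ its] /=.
  rewrite -(mfo i 0 its isT) -(mfo i 1 its isT) -(mfo i 2 its isT).
  by congr (mf _, mf _, mf _); lia.
rewrite outE'; split.
  rewrite map_inj_in_uniq ?filter_uniq ?tuples_uniq // => s s'.
  rewrite !mem_filter !mem_tuples => /and3P[_ + _] /and3P[_ + _].
  by case: s => [|? [|? [|? [|? ?]]]] //; case: s' => [|? [|? [|? [|? ?]]]] //= _ _ [-> -> ->].
move=> a b c; split.
  case/mapP => s; rewrite mem_filter mem_tuples /hit => /andP[+ /andP[]].
  case: s => [|x [|y [|z [|? ?]]]] //= + _ /and4P[xq yq zq _] [-> -> ->].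
  by move/tab; apply.
case=> wp adm; have [aq bq cq] : [/\ a < q, b < q & c < q] by split; lia.
apply/mapP; exists [:: a; b; c] => //.
rewrite mem_filter mem_tuples /= aq bq cq /hit /= andbT.
by apply/tab.
Qed.

End Main.

(** From [p + 1 <= 2 * maxn p 1] comes the factor [2 ^ 7]. In units of
    [n * (p + 1) ^ 7 * nest_cost], the scan of the code takes at most 4, the listing 1 and the
    constant rest 1, which makes 6. *)
Lemma running_time n p l : 0 < n -> l <= 2 * n ->
  l * ((p + 1) ^ 7 * nest_cost + 100) + (p + 1) ^ 3 * 1000 + 200 <=
  6 * nest_cost * 2 ^ 7 * (n * maxn p 1 ^ 7).
Proof.
move=> n0 ln; have N1 : 1000 <= nest_cost by [].
have q7 : (p + 1) ^ 7 <= 2 ^ 7 * maxn p 1 ^ 7 by rewrite -expnMn leq_exp2r //; lia.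
have q37 : (p + 1) ^ 3 <= (p + 1) ^ 7 by rewrite leq_pexp2l // addn1.
have q0 : 0 < (p + 1) ^ 7 by rewrite expn_gt0 addn1.
move: N1 q7 q37 q0; move: nest_cost (2 ^ 7) (maxn p 1 ^ 7) ((p + 1) ^ 7) ((p + 1) ^ 3).
move=> N d r7 q7 q3 N1 hq7 q37 q0.
have NZ : N <= q7 * N by rewrite leq_pmull.
have nZ : q7 * N <= n * (q7 * N) by rewrite leq_pmull.
have h1 : l * (q7 * N + 100) <= 2 * n * (2 * (q7 * N)) by apply: leq_mul => //; lia.
have h2 : q3 * 1000 <= q7 * N by apply: leq_mul.
have h3 : n * (q7 * N) <= n * (d * r7 * N) by rewrite leq_mul2l leq_mul2r hq7 !orbT.
have -> : 6 * N * d * (n * r7) = 6 * (n * (d * r7 * N)) by lia.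
lia.
Qed.

(** The tables end near [2 * Y ^ 4], so the eighth power has room to spare; [81 * Y] dominates the
    remaining quantities that have to fit into a cell. *)
Lemma word_size p l Y : p + 1 <= Y -> l <= 2 * Y -> 3 <= Y ->
  [/\ (p + 1) ^ 3 < Y ^ 8, table_address l p l 0 0 0 < Y ^ 8 & 81 * Y < Y ^ 8].
Proof.
move=> qY lY Y3.
have Y4 : 27 * Y <= Y ^ 4 by rewrite (expnD Y 3 1) expn1 leq_mul2r (@leq_exp2r 3 Y 3) ?Y3 ?orbT.
have Y8 : 81 * Y ^ 4 <= Y ^ 8.
  by rewrite (expnD Y 4 4) leq_mul2r (@leq_exp2r 3 Y 4) ?Y3 ?orbT.
have q3 : (p + 1) ^ 3 <= Y ^ 3 by rewrite leq_exp2r.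
have h : Y ^ 3 * Y = Y ^ 4 by rewrite -expnSr.
rewrite /table_address !mul0n !addn0 [(p + 1) * _](_ : _ = (p + 1) ^ 3) //.
move: Y4 Y8 q3 h; move: (Y ^ 8) (Y ^ 4) (Y ^ 3) ((p + 1) ^ 3) => y8 y4 y3 q3 h1 h2 h3 h4.
have h5 : l * q3 <= 2 * Y * y3 by apply: leq_mul.
have h6 : 2 * Y * y3 = 2 * y4 by rewrite -h4; lia.
have h7 : y3 <= y4 by rewrite -h4 leq_pmulr //; lia.
by split; lia.
Qed.

(* The program M and the constants C, k depend neither on p nor on the graph.
   Machine words have O(log (n + p)) bits. *)
Theorem theorem13 :
  exists (M : program) (C k : nat),
  forall (p n : nat) (e : rel 'I_n),
    0 < n -> symmetric e -> irreflexive e -> is_cograph e ->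
    (exists t : cotree 'I_n, cotree_of e t) /\
    (forall t : cotree 'I_n, cotree_of e t ->
     exists (s : nat) (m : memory),
       [/\ exec ((n + p).+2 ^ k) M (input p t) s m,
           s <= C * (n * maxn p 1 ^ 7),
           uniq (output m)
         & forall T : triple,
             T \in output m <-> weight T <= p /\ admits_partition e T]).
Proof.
(* The eighth power of [(n + p).+2] bounds the contents of all cells, and the 200th power of that
   bounds every intermediate value. *)
exists mainM, (6 * nest_cost * 2 ^ 7), (8 * 200) => p n e n0 se ie ce; split.
  have [|t [pt et]] := cotree_exists (S := [set: 'I_n]) se ie ce.
    by rewrite cardsT card_ord.
  exists t; split; last by move=> u v; apply: et; rewrite inE.
  by apply: perm_trans pt _; rewrite enum_setT enumT perm_refl.
move=> t tP; have [pt _] := tP.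
have sl : size (leaves t) = n by rewrite (perm_size pt) size_enum_ord.
have := size_cotree_code t; rewrite sl => Ln.
have Y3 : 3 <= (n + p).+2 by lia.
have [||q3X outX YX] := @word_size p (size (cotree_code t)) _ _ _ Y3; [lia | lia |].
move: YX q3X outX; rewrite expnM; move: (_ ^ 8) => X YX q3X outX.
have [|||||s [m [ex sB [un out]]]] := @runs_main (X ^ 200) X n p t _ (leqnn _) _ _ _ q3X outX
  (6 * nest_cost * 2 ^ 7 * (n * maxn p 1 ^ 7)).
- by lia.
- by lia.
- by lia.
- by lia.
- by apply: running_time n0 _; lia.
exists s, m; split=> // -[[a b] c]; rewrite out /=.
by split=> -[? ?]; split=> //; apply/(admits_cotree _ _ _ se ie tP).
Qed.
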